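(* Let $\mathbf G_2$ be the set of all unlabelled 2-graphs and consider the formal series $$X=\sum_{\Gamma\in\mathbf G_2}\frac{\Gamma}{|\mathrm{Aut}\,\Gamma|},\qquad X^{\gamma}=\sum_{\substack{\Gamma\in\mathbf G_2\ \text{connected}\\ \partial\Gamma\cong\gamma}}\frac{\Gamma}{|\mathrm{Aut}\,\Gamma|}$$ for an unlabelled 1-graph $\gamma$. Then, with $\Delta$ extended termwise to formal series, $$\Delta X=\sum_{\Gamma\in\mathbf G_2}\Big(\prod_{v\in\mathcal V_\Gamma}|\mathrm{Aut}\,\gamma_v|\,X^{\gamma_v}\Big)\otimes\frac{\Gamma}{|\mathrm{Aut}\,\Gamma|},$$ where $\gamma_v$ is the vertex graph of the vertex $v$ of $\Gamma$, $\mathrm{Aut}\,\gamma_v$ its group of 1-graph automorphisms, and the product on the left tensor factor is disjoint union.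
   Context: A 1-graph is $(\mathcal V,\mathcal H,\nu,\iota)$: finite sets, $\nu:\mathcal H\to\mathcal V$, $\iota$ an involution of $\mathcal H$; a 1-graph isomorphism is a pair of bijections intertwining $\nu$ and $\iota$. A 2-graph is $G=(\mathcal V,\mathcal H,\nu,\iota;\mathcal S,\mu,\sigma_1,\sigma_2)$: a 1-graph plus a finite set $\mathcal S$ of strand sections, $\mu:\mathcal S\to\mathcal H$, a fixed-point free involution $\sigma_1$ of $\mathcal S$ with $\nu\circ\mu\circ\sigma_1=\nu\circ\mu$, and an involution $\sigma_2$ of $\mathcal S$ with $\iota\circ\mu=\mu\circ\sigma_2$ such that $s$ is fixed by $\sigma_2$ iff $\mu(s)$ is fixed by $\iota$. Edges are two-element orbits of $\iota$, edge strands two-element orbits of $\sigma_2$; fixed points are external. Connectedness refers to the underlying 1-graph. The vertex graph of $v$ is the 1-graph $\gamma_v=(\nu^{-1}(v),(\nu\circ\mu)^{-1}(v),\mu|,\sigma_1|)$. A subgraph $H\subseteq G$ differs from $G$ only in having a subset of the edges and correspondingly a subset of the edge strands (the others becoming external). An external face of $H$ is a tuple $(s_1,\dots,s_{2n})$ of distinct strand sections with $s_{2i}=\sigma_1(s_{2i-1})$, $s_{2i+1}=\sigma_{2,H}(s_{2i})$, $s_1,s_{2n}$ fixed by $\sigma_{2,H}$. The contraction $G/H$ has vertices the connected components of $H$, half-edges and strand sections the external ones of $H$, $\nu$ mapping to the component, $\mu$ restricted, edges and edge strands those of $G$ not in $H$, and $\sigma_1$ pairing $s_1$ with $s_{2n}$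 for each external face of $H$. 2-graph isomorphisms are triples of bijections of vertices, half-edges, strand sections intertwining all structure; unlabelled 2-graphs are isomorphism classes and $\mathrm{Aut}\,\Gamma$ is the automorphism group. The boundary of a connected 2-graph $\Gamma$ is $\partial\Gamma:=$ the vertex graph of the single vertex of $\Gamma/\Gamma$. $\mathcal G$ is the $\mathbb Q$-algebra with basis the unlabelled 2-graphs, product disjoint union (unit the empty 2-graph), with coproduct $\Delta(\Gamma)=\sum_{\Theta\subseteq\Gamma}\Theta\otimes\Gamma/\Theta$ (sum over subgraphs of a representative); formal series are infinite linear combinations of basis elements (resp. of tensors of basis elements), and the coefficients in the identity are finite. *)

(* Defs.v *)
From HB Require Import structures.
From mathcomp Require Import all_boot all_order all_algebra.
Set Implicit Arguments. Unset Strict Implicit. Unset Printing Implicit Defensive.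
Import GRing.Theory Num.Theory.

Definition bijb (A B : finType) (f : {ffun A -> B}) : bool :=
  [exists g : {ffun B -> A}, [forall x, g (f x) == x] && [forall y, f (g y) == y]].

(* 1-graphs: (V, H, nu, iota).  iota is required to be an involution
   only where relevant; 1-graphs here only arise as vertex graphs.      *)
Record graph1 := Graph1 {
  V1 : finType; H1 : finType;
  nu1 : H1 -> V1; iota1 : H1 -> H1 }.

Definition is_iso1 (G G' : graph1) (fV : {ffun V1 G -> V1 G'})
  (fH : {ffun H1 G -> H1 G'}) : bool :=
  [&& bijb fV, bijb fH,
      [forall h, fV (nu1 h) == nu1 (fH h)] &
      [forall h, fH (iota1 h) == iota1 (fH h)]].

Definition iso1b (G G' : graph1) : bool :=
  [exists fV, exists fH, @is_iso1 G G' fV fH].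

Definition aut1 (G : graph1) : nat :=
  #|[set p : {ffun V1 G -> V1 G} * {ffun H1 G -> H1 G} | is_iso1 p.1 p.2]|.

Definition empty1 : graph1 := @Graph1 void void (fun x => x) (fun x => x).

Record graph2 := Graph2 {
  gV : finType; gH : finType; gS : finType;
  gnu : gH -> gV; giota : gH -> gH;
  gmu : gS -> gH; gs1 : gS -> gS; gs2 : gS -> gS }.
Arguments gnu : clear implicits. Arguments giota : clear implicits.
Arguments gmu : clear implicits. Arguments gs1 : clear implicits.
Arguments gs2 : clear implicits.

Definition valid2 (G : graph2) : bool :=
  [&& [forall h, giota G (giota G h) == h],
      [forall s, gs1 G (gs1 G s) == s],
      [forall s, gs1 G s != s],
      [forall s, gnu G (gmu G (gs1 G s)) == gnu G (gmu G s)],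
      [forall s, gs2 G (gs2 G s) == s],
      [forall s, giota G (gmu G s) == gmu G (gs2 G s)] &
      [forall s, (gs2 G s == s) == (giota G (gmu G s) == gmu G s)]].

Definition is_iso2 (G G' : graph2) (fV : {ffun gV G -> gV G'})
  (fH : {ffun gH G -> gH G'}) (fS : {ffun gS G -> gS G'}) : bool :=
  [&& bijb fV, bijb fH, bijb fS,
      [forall h, fV (gnu G h) == gnu G' (fH h)],
      [forall h, fH (giota G h) == giota G' (fH h)],
      [forall s, fH (gmu G s) == gmu G' (fS s)],
      [forall s, fS (gs1 G s) == gs1 G' (fS s)] &
      [forall s, fS (gs2 G s) == gs2 G' (fS s)]].

Definition iso2b (G G' : graph2) : bool :=
  [exists fV, exists fH, exists fS, @is_iso2 G G' fV fH fS].

Definition aut2 (G : graph2) : nat :=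
  #|[set p : {ffun gV G -> gV G} * {ffun gH G -> gH G} * {ffun gS G -> gS G}
        | is_iso2 p.1.1 p.1.2 p.2]|.

(* Subgraphs: a subgraph is given by its set of edges, encoded as an
   iota-closed set E of non-external half-edges.                        *)
Definition edgeset (G : graph2) (E : {set gH G}) : bool :=
  [forall h in E, (giota G h != h) && (giota G h \in E)].

Definition iotaE (G : graph2) (E : {set gH G}) (h : gH G) : gH G :=
  if h \in E then giota G h else h.
Definition s2E (G : graph2) (E : {set gH G}) (s : gS G) : gS G :=
  if gmu G s \in E then gs2 G s else s.

Definition subg (G : graph2) (E : {set gH G}) : graph2 :=
  @Graph2 (gV G) (gH G) (gS G) (gnu G) (iotaE E) (gmu G) (gs1 G) (s2E E).

Definition all_edges (G : graph2) : {set gH G} := [set h | giota G h != h].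

Definition adjE (G : graph2) (E : {set gH G}) : rel (gV G) :=
  fun v w => [exists h, (gnu G h == v) && (gnu G (iotaE E h) == w)]
          || [exists h, (gnu G h == w) && (gnu G (iotaE E h) == v)].
Definition comp_of (G : graph2) (E : {set gH G}) (v : gV G) : {set gV G} :=
  [set w | connect (adjE E) v w].
Definition comps (G : graph2) (E : {set gH G}) : {set {set gV G}} :=
  (comp_of E) @: [set: gV G].

Definition connected2 (G : graph2) : bool := #|comps (all_edges G)| == 1.

(* Faces: for an external strand section s of the subgraph, the other end
   s_{2n} of the external face (s = s_1, s_2, ..., s_{2n}). *)
Definition face_end (G : graph2) (E : {set gH G}) (s : gS G) : gS G :=
  let t := fun x => s2E E (gs1 G x) in
  let k := find (fun i => s2E E (gs1 G (iter i t s)) == gs1 G (iter i t s))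
                (iota 0 #|gS G|) in
  gs1 G (iter k t s).

Lemma andb_r (a b : bool) : a && b -> b.
Proof. by case/andP. Qed.

(* Carriers of G / Theta.  The extra conjunct in the strand carrier, and
   the "odflt x (insub ..)" fallbacks, are vacuous for valid 2-graphs. *)
Definition cV (G : graph2) (E : {set gH G}) := {C : {set gV G} | C \in comps E}.
Definition cH (G : graph2) (E : {set gH G}) := {h : gH G | iotaE E h == h}.
Definition cS (G : graph2) (E : {set gH G}) :=
  {s : gS G | (s2E E s == s) && (iotaE E (gmu G s) == gmu G s)}.

Definition contr (G : graph2) (E : {set gH G}) : graph2 :=
  @Graph2 (cV E) (cH E) (cS E)
    (fun h => exist (fun C => C \in comps E) (comp_of E (gnu G (val h)))
                    (imset_f (comp_of E) (in_setT (gnu G (val h)))))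
    (fun h => odflt h (insub (giota G (val h))))
    (fun s => exist (fun h => iotaE E h == h) (gmu G (val s)) (andb_r (valP s)))
    (fun s => odflt s (insub (face_end E (val s))))
    (fun s => odflt s (insub (gs2 G (val s)))).

Definition vgraph (G : graph2) (v : gV G) : graph1 :=
  @Graph1 {h : gH G | gnu G h == v} {s : gS G | gnu G (gmu G s) == v}
    (fun s => exist (fun h => gnu G h == v) (gmu G (val s)) (valP s))
    (fun s => odflt s (insub (gs1 G (val s)))).

(* boundary: vertex graph of the single vertex of G / G *)
Definition bdry (G : graph2) : graph1 :=
  let Q := contr (all_edges G) in
  match [pick v : gV Q] with Some v => vgraph v | None => empty1 end.

Definition dunion (I : finType) (F : I -> graph2) : graph2 :=
  @Graph2 {i : I & gV (F i)} {i : I & gH (F i)} {i : I & gS (F i)}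
    (fun x => Tagged (fun i => gV (F i)) (gnu (F (tag x)) (tagged x)))
    (fun x => Tagged (fun i => gH (F i)) (giota (F (tag x)) (tagged x)))
    (fun x => Tagged (fun i => gH (F i)) (gmu (F (tag x)) (tagged x)))
    (fun x => Tagged (fun i => gS (F i)) (gs1 (F (tag x)) (tagged x)))
    (fun x => Tagged (fun i => gS (F i)) (gs2 (F (tag x)) (tagged x))).

(* Labelled representatives on ordinal carriers, used to sum over
   isomorphism classes (unlabelled 2-graphs).                          *)
Definition Raw (a b c : nat) :=
  ({ffun 'I_b -> 'I_a} * {ffun 'I_b -> 'I_b} * {ffun 'I_c -> 'I_b}
   * {ffun 'I_c -> 'I_c} * {ffun 'I_c -> 'I_c})%type.

Definition ograph (a b c : nat) (d : Raw a b c) : graph2 :=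
  @Graph2 'I_a 'I_b 'I_c d.1.1.1.1 d.1.1.1.2 d.1.1.2 d.1.2 d.2.

Open Scope ring_scope.

(* Sum of g over the isomorphism classes of 2-graphs with #V = a, #H = b,
   #S = c: each class is counted once (g should be iso-invariant). *)
Definition classsum (a b c : nat) (g : graph2 -> rat) : rat :=
  \sum_(d : Raw a b c | valid2 (ograph d))
     g (ograph d) / (#|[set d' : Raw a b c | iso2b (ograph d') (ograph d)]|)%:R.

(* Coefficients of formal series: a formal series in G is an
   iso-invariant function graph2 -> rat (coefficient of the class),
   a formal series in G (x) G a function graph2 -> graph2 -> rat.      *)

Definition Xser (G : graph2) : rat := (valid2 G)%:R / (aut2 G)%:R.

Definition Xgam (gam : graph1) (G : graph2) : rat :=
  [&& valid2 G, connected2 G & iso1b (bdry G) gam]%:R / (aut2 G)%:R.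

(* Delta X, extended termwise: coefficient of [A] (x) [B] is
   sum_{classes Gamma} X_Gamma * #{Theta <= Gamma | Theta ~ A, Gamma/Theta ~ B}.
   A subgraph of Gamma has the same vertices, half-edges and strand
   sections as Gamma, so only classes of the sizes of A contribute. *)
Definition DeltaX5 (A B : graph2) : rat :=
  classsum #|gV A| #|gH A| #|gS A| (fun G =>
    Xser G * (#|[set E : {set gH G} |
                  [&& edgeset E, iso2b (subg E) A & iso2b (contr E) B]]|)%:R).

Definition Box (a b c : nat) :=
  {n : 'I_a.+1 * 'I_b.+1 * 'I_c.+1 & Raw n.1.1 n.1.2 n.2}.
Definition oG (a b c : nat) (x : Box a b c) : graph2 := ograph (tagged x).
Definition clsz (a b c : nat) (x : Box a b c) : nat :=
  #|[set y : Box a b c | iso2b (oG y) (oG x)]|.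

(* Coefficient at [A] of the product (disjoint union) over the vertices v
   of Gamma of the series |Aut gamma_v| X^{gamma_v}: sum over families
   of classes (C_v)_v with disjoint union isomorphic to A.  Components
   of such a union have sizes bounded by those of A. *)
Definition prodcoef (G : graph2) (A : graph2) : rat :=
  let a := #|gV A| in let b := #|gH A| in let c := #|gS A| in
  \sum_(t : {ffun gV G -> Box a b c})
     (iso2b (dunion (fun v => oG (t v))) A)%:R *
     \prod_(v : gV G)
        ((clsz (t v))%:R^-1 * (aut1 (vgraph v))%:R * Xgam (vgraph v) (oG (t v))).

Definition RHS5 (A B : graph2) : rat :=
  classsum #|gV B| #|gH B| #|gS B| (fun G =>
    prodcoef G A * ((iso2b G B)%:R / (aut2 G)%:R)).

(* Main.v *)
Require Import Defs.
From mathcomp Require Import all_boot all_order all_algebra.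
Set Implicit Arguments. Unset Strict Implicit. Unset Printing Implicit Defensive.
Import GRing.Theory Num.Theory.

(** Both coefficients at [A] (x) [B] equal
      [#Iso(core (A/A), core B) / (#Aut A * #Aut B)],
    where [core] forgets the edges and edge strands.  On the left, a 2-graph
    with a subgraph isomorphic to [A] and contraction isomorphic to [B] is the
    same as a way of turning the residue [A/A] into [B], since only the
    involutions on the external part of [A] are free.  On the right, an
    isomorphism from [core (A/A)] to [core B] assigns to each vertex [v] of [B]
    a component of [A] whose boundary is identified with the vertex graph of
    [v]; the triples (family of connected 2-graphs, isomorphism of its disjoint
    union with [A], matching isomorphism of the residue) are counted in two
    ways.  Sums over isomorphism classes become sums over labelled 2-graphs
    because (size of the class) * #Aut is a product of factorials. *)

(** * Embeddings and isomorphisms of 2-graphs *)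

(** Counting along a [Prop]-valued relation lets the correspondence be built from mere existence
    statements; finite choice turns it into an injective function on [S1]. *)
Lemma card_le_rel (T1 T2 : finType) (S1 : {set T1}) (S2 : {set T2})
    (R : T1 -> T2 -> Prop) :
  (forall x, x \in S1 -> exists2 y, y \in S2 & R x y) ->
  (forall x x' y, x \in S1 -> x' \in S1 -> R x y -> R x' y -> x = x') ->
  (#|S1| <= #|S2|)%N.
Proof.
move=> tot inj.
have [f fP] : exists f : {x | x \in S1} -> T2,
    forall u, f u \in S2 /\ R (val u) (f u).
  apply: (@fin_all_exists _ (fun=> T2)
            (fun u v => v \in S2 /\ R (val u) v)) => u.
  by have [y yS Ry] := tot _ (valP u); exists y.
have injf : injective f.
  move=> u v fE; apply: val_inj; apply: (inj _ _ (f u)); try exact: valP.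
    by case: (fP u).
  by rewrite fE; case: (fP v).
rewrite -card_sig -(card_codom injf); apply: subset_leq_card.
by apply/subsetP => _ /codomP[u ->]; case: (fP u).
Qed.

Lemma eq_card_rel (T1 T2 : finType) (S1 : {set T1}) (S2 : {set T2})
    (R : T1 -> T2 -> Prop) :
  (forall x, x \in S1 -> exists2 y, y \in S2 & R x y) ->
  (forall y, y \in S2 -> exists2 x, x \in S1 & R x y) ->
  (forall x x' y, x \in S1 -> x' \in S1 -> R x y -> R x' y -> x = x') ->
  (forall x y y', y \in S2 -> y' \in S2 -> R x y -> R x y' -> y = y') ->
  #|S1| = #|S2|.
Proof.
move=> tot sur inj fn; apply/eqP; rewrite eqn_leq; apply/andP; split.
  exact: card_le_rel tot inj.
apply: (card_le_rel (R := fun y x => R x y)) => // y y' x yS y'S; exact: fn.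
Qed.

Lemma bijbP (A B : finType) (f : {ffun A -> B}) :
  reflect (bijective f) (bijb f).
Proof.
apply: (iffP existsP) => [[g /andP[/forallP gf /forallP fg]]|[g gf fg]].
  by exists g => x; apply/eqP.
by exists [ffun y => g y]; apply/andP; split; apply/forallP => x;
  rewrite ffunE ?gf ?fg.
Qed.

Definition tri (X Y : graph2) : finType :=
  ({ffun gV X -> gV Y} * {ffun gH X -> gH Y} * {ffun gS X -> gS Y})%type.

Section Triples.
Variables X Y : graph2.
Implicit Type f : tri X Y.

Definition tV f : {ffun gV X -> gV Y} := f.1.1.
Definition tH f : {ffun gH X -> gH Y} := f.1.2.
Definition tS f : {ffun gS X -> gS Y} := f.2.

(** [locked] keeps simplification from exposing the finite functions; values are read through [mkV],
    [mkH] and [mkS]. *)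
Definition mktri fV fH fS : tri X Y :=
  locked ([ffun x => fV x], [ffun x => fH x], [ffun x => fS x]).

Lemma mkV fV fH fS x : tV (mktri fV fH fS) x = fV x.
Proof. by rewrite /tV /mktri -lock /= ffunE. Qed.
Lemma mkH fV fH fS x : tH (mktri fV fH fS) x = fH x.
Proof. by rewrite /tH /mktri -lock /= ffunE. Qed.
Lemma mkS fV fH fS x : tS (mktri fV fH fS) x = fS x.
Proof. by rewrite /tS /mktri -lock /= ffunE. Qed.

Lemma tri_eq f g : tV f =1 tV g -> tH f =1 tH g -> tS f =1 tS g -> f = g.
Proof.
case: f g => [[a b] c] [[a' b'] c'] /=.
by rewrite /tV /tH /tS /= => /ffunP-> /ffunP-> /ffunP->.
Qed.

Definition isos : {set tri X Y} := [set p : tri X Y | is_iso2 p.1.1 p.1.2 p.2].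

Lemma iso2bE : iso2b X Y = (0 < #|isos|)%N.
Proof.
rewrite card_gt0; apply/existsP/set0Pn.
  by move=> [a /existsP[b /existsP[c i]]]; exists (a, b, c); rewrite inE.
move=> [[[a b] c]]; rewrite inE /= => i.
by exists a; apply/existsP; exists b; apply/existsP; exists c.
Qed.

(* Embeddings onto a union of connected components: every half-edge (strand
   section) attached to the image is in the image. *)
Record emb f : Prop := Emb {
  emb_injV : injective (tV f);
  emb_injH : injective (tH f);
  emb_injS : injective (tS f);
  emb_nu : forall h, tV f (gnu X h) = gnu Y (tH f h);
  emb_iota : forall h, tH f (giota X h) = giota Y (tH f h);
  emb_mu : forall s, tH f (gmu X s) = gmu Y (tS f s);
  emb_s1 : forall s, tS f (gs1 X s) = gs1 Y (tS f s);
  emb_s2 : forall s, tS f (gs2 X s) = gs2 Y (tS f s);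
  emb_fullH : forall x y, tV f x = gnu Y y -> exists h, y = tH f h;
  emb_fullS : forall h s, tH f h = gmu Y s -> exists s', s = tS f s' }.

Definition surV f : Prop := forall y, exists x, y = tV f x.

Lemma emb_surH f : emb f -> surV f -> forall y, exists x, y = tH f x.
Proof.
move=> ef sf y; have [x xE] := sf (gnu Y y).
by apply: (emb_fullH ef (x := x)).
Qed.

Lemma emb_surS f : emb f -> surV f -> forall y, exists x, y = tS f x.
Proof.
move=> ef sf y; have [x xE] := emb_surH ef sf (gmu Y y).
by apply: (emb_fullS ef (h := x)).
Qed.

(** Fullness propagates surjectivity from vertices to half-edges and then to strand sections, so an
    isomorphism is an embedding that is onto on vertices. *)
Lemma isosP f : (f \in isos) <-> emb f /\ surV f.
Proof.
rewrite inE; split.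
  case: f => [[a b] c] /and5P[/= /bijbP ba /bijbP bb /bijbP bc /forallP nu].
  case/and4P=> /forallP io /forallP mu /forallP s1 /forallP s2.
  split; last by move=> y; case: ba => g _ fg; exists (g y).
  split; try exact: bij_inj; try by move=> h; apply/eqP.
    by move=> _ y _; case: bb => g _ fg; exists (g y).
  by move=> _ y _; case: bc => g _ fg; exists (g y).
move=> [ef sf].
have bij (S T : finType) (g : {ffun S -> T}) :
    injective g -> (forall y, exists x, y = g x) -> bijb g.
  move=> ig sg; apply/bijbP; apply: (inj_card_bij ig).
  rewrite -(card_codom ig); apply: subset_leq_card.
  by apply/subsetP => y _; have [x ->] := sg y; apply: codom_f.
apply/and5P; split; [apply: bij| apply: bij| apply: bij| | apply/and4P; split].
- exact: emb_injV ef.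
- exact: sf.
- exact: emb_injH ef.
- exact: emb_surH ef sf.
- exact: emb_injS ef.
- exact: emb_surS ef sf.
- by apply/forallP => h; apply/eqP; exact: (emb_nu ef).
- by apply/forallP => h; apply/eqP; exact: (emb_iota ef).
- by apply/forallP => h; apply/eqP; exact: (emb_mu ef).
- by apply/forallP => h; apply/eqP; exact: (emb_s1 ef).
- by apply/forallP => h; apply/eqP; exact: (emb_s2 ef).
Qed.

End Triples.

Definition comp3 X Y Z (g : tri Y Z) (f : tri X Y) : tri X Z :=
  mktri (fun x => tV g (tV f x)) (fun x => tH g (tH f x)) (fun x => tS g (tS f x)).

Lemma emb_comp X Y Z (g : tri Y Z) (f : tri X Y) :
  emb g -> emb f -> emb (comp3 g f).
Proof.
move=> eg ef; split.
- by move=> x y; rewrite !mkV => /(emb_injV eg)/(emb_injV ef).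
- by move=> x y; rewrite !mkH => /(emb_injH eg)/(emb_injH ef).
- by move=> x y; rewrite !mkS => /(emb_injS eg)/(emb_injS ef).
- by move=> h; rewrite mkV mkH (emb_nu ef) (emb_nu eg).
- by move=> h; rewrite !mkH (emb_iota ef) (emb_iota eg).
- by move=> h; rewrite mkH mkS (emb_mu ef) (emb_mu eg).
- by move=> h; rewrite !mkS (emb_s1 ef) (emb_s1 eg).
- by move=> h; rewrite !mkS (emb_s2 ef) (emb_s2 eg).
- move=> x y; rewrite mkV => e; have [h hE] := emb_fullH eg e.
  have [h' h'E] : exists h', h = tH f h'.
    apply: (emb_fullH ef (x := x)); apply: (emb_injV eg).
    by rewrite e hE (emb_nu eg).
  by exists h'; rewrite mkH -h'E.
- move=> x y; rewrite mkH => e; have [h hE] := emb_fullS eg e.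
  have [h' h'E] : exists h', h = tS f h'.
    apply: (emb_fullS ef (h := x)); apply: (emb_injH eg).
    by rewrite e hE (emb_mu eg).
  by exists h'; rewrite mkS -h'E.
Qed.

Lemma iso_comp X Y Z (g : tri Y Z) (f : tri X Y) :
  g \in isos Y Z -> f \in isos X Y -> comp3 g f \in isos X Z.
Proof.
move=> /isosP[eg sg] /isosP[ef sf]; apply/isosP; split; first exact: emb_comp.
by move=> z; have [y ->] := sg z; have [x ->] := sf y; exists x; rewrite mkV.
Qed.

(** Containment of the vertex images suffices, because fullness of [e] lifts the half-edges and
    strand sections as well. The properties of [g] follow by cancelling the injective maps [e] and
    [f]. *)
Lemma emb_factor X Y Z (e : tri Y Z) (f : tri X Z) :
  emb e -> emb f -> (forall x, exists y, tV f x = tV e y) ->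
  exists g : tri X Y, [/\ emb g, forall x, tV f x = tV e (tV g x),
    forall x, tH f x = tH e (tH g x) & forall x, tS f x = tS e (tS g x)].
Proof.
move=> ee ef /fin_all_exists[gV gVE].
have /fin_all_exists[gH gHE] : forall x, exists y, tH f x = tH e y.
  move=> x; have E : tV e (gV (gnu X x)) = gnu Z (tH f x).
    by rewrite -gVE (emb_nu ef).
  exact: (emb_fullH ee E).
have /fin_all_exists[gS gSE] : forall x, exists y, tS f x = tS e y.
  move=> x; have E : tH e (gH (gmu X x)) = gmu Z (tS f x).
    by rewrite -gHE (emb_mu ef).
  exact: (emb_fullS ee E).
exists (mktri gV gH gS); split; try by move=> x; rewrite ?mkV ?mkH ?mkS.
split.
- by move=> x y; rewrite !mkV => E; apply: (emb_injV ef); rewrite !gVE E.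
- by move=> x y; rewrite !mkH => E; apply: (emb_injH ef); rewrite !gHE E.
- by move=> x y; rewrite !mkS => E; apply: (emb_injS ef); rewrite !gSE E.
- move=> h; rewrite mkV mkH; apply: (emb_injV ee).
  by rewrite -gVE (emb_nu ef) (emb_nu ee) -gHE.
- move=> h; rewrite !mkH; apply: (emb_injH ee).
  by rewrite -gHE (emb_iota ef) (emb_iota ee) -gHE.
- move=> h; rewrite mkH mkS; apply: (emb_injH ee).
  by rewrite -gHE (emb_mu ef) (emb_mu ee) -gSE.
- move=> h; rewrite !mkS; apply: (emb_injS ee).
  by rewrite -gSE (emb_s1 ef) (emb_s1 ee) -gSE.
- move=> h; rewrite !mkS; apply: (emb_injS ee).
  by rewrite -gSE (emb_s2 ef) (emb_s2 ee) -gSE.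
- move=> x y; rewrite mkV => E.
  have [h hE] : exists h, tH e y = tH f h.
    by apply: (emb_fullH ef (x := x)); rewrite gVE E (emb_nu ee).
  by exists h; rewrite mkH; apply: (emb_injH ee); rewrite hE gHE.
- move=> x y; rewrite mkH => E.
  have [h hE] : exists h, tS e y = tS f h.
    by apply: (emb_fullS ef (h := x)); rewrite gHE E (emb_mu ee).
  by exists h; rewrite mkS; apply: (emb_injS ee); rewrite hE gSE.
Qed.

Lemma emb_id X : emb (mktri id id id : tri X X).
Proof.
split; try by move=> x y; rewrite ?mkV ?mkH ?mkS.
- by move=> h; rewrite mkV mkH.
- by move=> h; rewrite !mkH.
- by move=> h; rewrite mkH mkS.
- by move=> h; rewrite !mkS.
- by move=> h; rewrite !mkS.
- by move=> _ y _; exists y; rewrite mkH.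
- by move=> _ y _; exists y; rewrite mkS.
Qed.

Lemma iso_id X : (mktri id id id : tri X X) \in isos X X.
Proof.
by apply/isosP; split; [exact: emb_id | move=> y; exists y; rewrite mkV].
Qed.

(** The inverse is the factorisation of the identity of [Y] through [f]. *)
Lemma iso_inv X Y (f : tri X Y) : f \in isos X Y ->
  exists2 g, g \in isos Y X & [/\ cancel (tV g) (tV f), cancel (tH g) (tH f) &
    cancel (tS g) (tS f)].
Proof.
move=> /isosP[ef sf].
have sub x : exists y, tV (mktri id id id : tri Y Y) x = tV f y.
  by rewrite mkV; apply: sf.
have [g [eg gV gH gS]] := emb_factor ef (emb_id Y) sub.
exists g; last by split=> x; rewrite -?gV -?gH -?gS ?mkV ?mkH ?mkS.
apply/isosP; split=> // x; exists (tV f x).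
by apply: (emb_injV ef); rewrite -gV mkV.
Qed.

Lemma comp3_injr X Y Z (g : tri Y Z) (f f' : tri X Y) :
  emb g -> comp3 g f = comp3 g f' -> f = f'.
Proof.
move=> eg E; apply: tri_eq => x.
- by apply: (emb_injV eg); move/(congr1 (fun q => tV q x)): E; rewrite !mkV.
- by apply: (emb_injH eg); move/(congr1 (fun q => tH q x)): E; rewrite !mkH.
- by apply: (emb_injS eg); move/(congr1 (fun q => tS q x)): E; rewrite !mkS.
Qed.

Lemma comp3_injl X Y Z (g g' : tri Y Z) (f : tri X Y) :
  emb f -> surV f -> comp3 g f = comp3 g' f -> g = g'.
Proof.
move=> ef sf E; apply: tri_eq => y.
- have [x ->] := sf y.
  by move/(congr1 (fun q => tV q x)): E; rewrite !mkV.
- have [x ->] := emb_surH ef sf y.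
  by move/(congr1 (fun q => tH q x)): E; rewrite !mkH.
- have [x ->] := emb_surS ef sf y.
  by move/(congr1 (fun q => tS q x)): E; rewrite !mkS.
Qed.

Lemma card_isos_r X Y Z (q : tri X Y) : q \in isos X Y ->
  #|isos Z X| = #|isos Z Y|.
Proof.
have le A B (r : tri A B) : r \in isos A B -> (#|isos Z A| <= #|isos Z B|)%N.
  move=> ri; apply: (card_le_rel (R := fun f g => g = comp3 r f)).
    by move=> f fi; exists (comp3 r f) => //; apply: iso_comp.
  by move=> f f' g _ _ -> /comp3_injr; apply; case/isosP: ri.
move=> qi; have [q' q'i _] := iso_inv qi.
by apply/eqP; rewrite eqn_leq !(le _ _ q, le _ _ q').
Qed.

Lemma card_isos_l X Y Z (q : tri X Y) : q \in isos X Y ->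
  #|isos X Z| = #|isos Y Z|.
Proof.
have le A B (r : tri A B) : r \in isos A B -> (#|isos B Z| <= #|isos A Z|)%N.
  move=> ri; apply: (card_le_rel (R := fun f g => g = comp3 f r)).
    by move=> f fi; exists (comp3 f r) => //; apply: iso_comp.
  by move=> f f' g _ _ ->; case/isosP: ri => er sr /comp3_injl; apply.
move=> qi; have [q' q'i _] := iso_inv qi.
by apply/eqP; rewrite eqn_leq !(le _ _ q, le _ _ q').
Qed.

Lemma aut2E G : aut2 G = #|isos G G|. Proof. by []. Qed.

(** The set of isomorphisms is either empty or, after composition with one of its members, in
    bijection with the automorphisms of [Y]. *)
Lemma card_isos X Y : #|isos X Y| = (iso2b X Y * aut2 Y)%N.
Proof.
rewrite iso2bE; case: ltnP => [|]; last by rewrite leqn0 => /eqP->.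
by rewrite card_gt0 mul1n => /set0Pn[q qi]; rewrite aut2E; apply: card_isos_l qi.
Qed.

Lemma aut2_gt0 G : (0 < aut2 G)%N.
Proof. by rewrite aut2E card_gt0; apply/set0Pn; exists (mktri id id id); apply: iso_id. Qed.

(** * Decompositions into disjoint pieces and gluing *)

Section Glue.
Variables (I : finType) (X : I -> graph2).

(** For embeddings [e i] this exhibits [Y] as the disjoint union of the [X i]; a condition on
    vertices is enough because the images are full. *)
Definition covers Y (e : forall i, tri (X i) Y) : Prop :=
  (forall i j x y, tV (e i) x = tV (e j) y -> i = j) /\
  (forall y, exists i x, y = tV (e i) x).

Section Cover.
Variables (Y : graph2) (e : forall i, tri (X i) Y).
Hypotheses (ee : forall i, emb (e i)) (ce : covers e).

Lemma coverV y : exists u : {i & gV (X i)}, y = tV (e (tag u)) (tagged u).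
Proof. by case: ce => _ /(_ y) [i [x ->]]; exists (existT _ i x). Qed.

Lemma coverH y : exists u : {i & gH (X i)}, y = tH (e (tag u)) (tagged u).
Proof.
case: ce => _ /(_ (gnu Y y)) [i [x xE]].
by have [h ->] := emb_fullH (ee i) (esym xE); exists (existT _ i h).
Qed.

Lemma coverS y : exists u : {i & gS (X i)}, y = tS (e (tag u)) (tagged u).
Proof.
have [[i h] /= hE] := coverH (gmu Y y).
by have [s ->] := emb_fullS (ee i) (esym hE); exists (existT _ i s).
Qed.

Lemma disjV i j x y : tV (e i) x = tV (e j) y -> i = j.
Proof. by case: ce => + _; apply. Qed.

Lemma disjH i j x y : tH (e i) x = tH (e j) y -> i = j.
Proof.
move/(congr1 (gnu Y)); rewrite -!emb_nu //; exact: disjV.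
Qed.

Lemma disjS i j x y : tS (e i) x = tS (e j) y -> i = j.
Proof.
move/(congr1 (gmu Y)); rewrite -!emb_mu //; exact: disjH.
Qed.
End Cover.

(** Universal property of the disjoint union: each element of [Y] comes from exactly one piece, by
    disjointness, and from one element of it, by injectivity, so the [f i] define a single map.
    Disjoint images in [Z] keep that map injective. *)
Lemma emb_glue Y Z (e : forall i, tri (X i) Y) (f : forall i, tri (X i) Z) :
  (forall i, emb (e i)) -> covers e -> (forall i, emb (f i)) ->
  (forall i j x y, tV (f i) x = tV (f j) y -> i = j) ->
  exists g : tri Y Z, [/\ emb g,
    forall i x, tV g (tV (e i) x) = tV (f i) x,
    forall i x, tH g (tH (e i) x) = tH (f i) x &
    forall i x, tS g (tS (e i) x) = tS (f i) x].
Proof.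
move=> ee ce ef df.
have dfH i j x y : tH (f i) x = tH (f j) y -> i = j.
  by move/(congr1 (gnu Z)); rewrite -!emb_nu //; apply: df.
have dfS i j x y : tS (f i) x = tS (f j) y -> i = j.
  by move/(congr1 (gmu Z)); rewrite -!emb_mu //; apply: dfH.
have /fin_all_exists[gV gVE] : forall y, exists z,
    forall i x, y = tV (e i) x -> z = tV (f i) x.
  move=> y; have [[i x] /= yE] := coverV ce y.
  exists (tV (f i) x) => j x'; rewrite yE => E.
  have ij := disjV ce E; case: j / ij x' E => x' /(emb_injV (ee i)) -> //.
have /fin_all_exists[gH gHE] : forall y, exists z,
    forall i x, y = tH (e i) x -> z = tH (f i) x.
  move=> y; have [[i x] /= yE] := coverH ee ce y.
  exists (tH (f i) x) => j x'; rewrite yE => E.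
  have ij := disjH ee ce E; case: j / ij x' E => x' /(emb_injH (ee i)) -> //.
have /fin_all_exists[gS gSE] : forall y, exists z,
    forall i x, y = tS (e i) x -> z = tS (f i) x.
  move=> y; have [[i x] /= yE] := coverS ee ce y.
  exists (tS (f i) x) => j x'; rewrite yE => E.
  have ij := disjS ee ce E; case: j / ij x' E => x' /(emb_injS (ee i)) -> //.
exists (mktri gV gH gS).
have kV i x : gV (tV (e i) x) = tV (f i) x by apply: gVE.
have kH i x : gH (tH (e i) x) = tH (f i) x by apply: gHE.
have kS i x : gS (tS (e i) x) = tS (f i) x by apply: gSE.
split; try by move=> i x; rewrite ?mkV ?mkH ?mkS.
split.
- move=> y y'; have [[i x] /= ->] := coverV ce y.
  have [[j x'] /= ->] := coverV ce y'; rewrite !mkV !kV => E.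
  have ij := df _ _ _ _ E; case: j / ij x' E => x' /(emb_injV (ef i)) -> //.
- move=> y y'; have [[i x] /= ->] := coverH ee ce y.
  have [[j x'] /= ->] := coverH ee ce y'; rewrite !mkH !kH => E.
  have ij := dfH _ _ _ _ E; case: j / ij x' E => x' /(emb_injH (ef i)) -> //.
- move=> y y'; have [[i x] /= ->] := coverS ee ce y.
  have [[j x'] /= ->] := coverS ee ce y'; rewrite !mkS !kS => E.
  have ij := dfS _ _ _ _ E; case: j / ij x' E => x' /(emb_injS (ef i)) -> //.
- move=> y; have [[i x] /= ->] := coverH ee ce y.
  by rewrite -(emb_nu (ee i)) mkV mkH kV kH (emb_nu (ef i)).
- move=> y; have [[i x] /= ->] := coverH ee ce y.
  by rewrite -(emb_iota (ee i)) !mkH !kH (emb_iota (ef i)).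
- move=> y; have [[i x] /= ->] := coverS ee ce y.
  by rewrite -(emb_mu (ee i)) mkH mkS kH kS (emb_mu (ef i)).
- move=> y; have [[i x] /= ->] := coverS ee ce y.
  by rewrite -(emb_s1 (ee i)) !mkS !kS (emb_s1 (ef i)).
- move=> y; have [[i x] /= ->] := coverS ee ce y.
  by rewrite -(emb_s2 (ee i)) !mkS !kS (emb_s2 (ef i)).
- move=> y z; have [[i x] /= ->] := coverV ce y; rewrite mkV kV => E.
  by have [h ->] := emb_fullH (ef i) E; exists (tH (e i) h); rewrite mkH kH.
- move=> y z; have [[i x] /= ->] := coverH ee ce y; rewrite mkH kH => E.
  by have [h ->] := emb_fullS (ef i) E; exists (tS (e i) h); rewrite mkS kS.
Qed.

End Glue.

Section ProdIsos.
Variables (I : finType) (X Y : I -> graph2) (A B : graph2).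
Variables (e : forall i, tri (X i) A) (f : forall i, tri (Y i) B).
Hypotheses (ee : forall i, emb (e i)) (ce : covers e).
Hypotheses (ef : forall i, emb (f i)) (cf : covers f).

(** Isomorphisms that respect the two decompositions, sending the piece of index [i] into the piece
    with the same index. *)
Definition isos_over : {set tri A B} :=
  [set p in isos A B |
     [forall i, forall x, exists y, tV p (tV (e i) x) == tV (f i) y]].

Let T i := tri (X i) (Y i).
Let families : {set {dffun forall i, T i}} :=
  [set P : {dffun forall i, T i} | [forall i, P i \in isos (X i) (Y i)]].

Lemma card_families : #|families| = (\prod_i #|isos (X i) (Y i)|)%N.
Proof.
have -> : #|families| =
    #|(family (fun i => mem (isos (X i) (Y i)))
        : simpl_pred {dffun forall i, T i})|.
  by apply: eq_card => P; rewrite inE.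
by rewrite card_family foldrE big_map big_enum; apply: eq_bigr.
Qed.

(** Restriction to the pieces, through [emb_factor], and gluing, through [emb_glue], are mutually
    inverse. *)
Lemma card_isos_over : #|isos_over| = (\prod_i #|isos (X i) (Y i)|)%N.
Proof.
rewrite -card_families.
pose R (p : tri A B) (P : {dffun forall i, T i}) :=
  forall i, comp3 p (e i) = comp3 (f i) (P i).
apply: (eq_card_rel (R := R)).
- move=> p; rewrite inE => /andP[/isosP[ep sp] /forallP over].
  have [P PE] : exists P : forall i, T i, forall i,
      P i \in isos (X i) (Y i) /\ comp3 p (e i) = comp3 (f i) (P i).
    apply: (@fin_all_exists _ T (fun i q =>
      q \in isos (X i) (Y i) /\ comp3 p (e i) = comp3 (f i) q)) => i.
    have sub x : exists y, tV (comp3 p (e i)) x = tV (f i) y.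
      by have /forallP/(_ x)/existsP[y /eqP yE] := over i; exists y; rewrite mkV.
    have [g [eg gV gH gS]] := emb_factor (ef i) (emb_comp ep (ee i)) sub.
    exists g; split; last first.
      by apply: tri_eq => x; rewrite ?gV ?gH ?gS ?mkV ?mkH ?mkS.
    (* The restriction is onto: a preimage of [y] under [p] lies in some piece [j], which [p] sends
       into piece [j], and disjointness in [B] forces [j] to be [i]. *)
    apply/isosP; split=> // y.
    have [a aE] := sp (tV (f i) y); have [[j x] /= axE] := coverV ce a.
    have /forallP/(_ x)/existsP[y' /eqP y'E] := over j.
    have ij : i = j by apply: (disjV cf (x := y) (y := y')); rewrite aE axE.
    case: j / ij x y' axE y'E => x y' axE y'E; exists x.
    by apply: (emb_injV (ef i)); rewrite -gV mkV -axE.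
  exists (finfun P : {dffun forall i, T i}).
    by rewrite inE; apply/forallP => i; rewrite ffunE; case: (PE i).
  by move=> i; rewrite ffunE; case: (PE i).
- move=> P; rewrite inE => /forallP PI.
  have ePf i : emb (comp3 (f i) (P i)).
    by apply: emb_comp => //; case/isosP: (PI i).
  have [| p [ep pV pH pS]] := emb_glue ee ce ePf.
    by move=> i j x y; rewrite !mkV; apply: disjV.
  exists p.
    rewrite inE; apply/andP; split.
      apply/isosP; split=> // b; have [[i y] /= ->] := coverV cf b.
      have /isosP[_ /(_ y) [x xE]] := PI i.
      by exists (tV (e i) x); rewrite pV mkV -xE.
    apply/forallP => i; apply/forallP => x; apply/existsP.
    by exists (tV (P i) x); rewrite pV mkV.
  by move=> i; apply: tri_eq => x; rewrite ?mkV ?mkH ?mkS ?pV ?pH ?pS ?mkV ?mkH ?mkS.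
- move=> p p' P _ _ Rp Rp'; have E i : comp3 p (e i) = comp3 p' (e i).
    by rewrite Rp Rp'.
  apply: tri_eq => a.
  + have [[i x] /= ->] := coverV ce a.
    by have /(congr1 (fun q => tV q x)) := E i; rewrite !mkV.
  + have [[i x] /= ->] := coverH ee ce a.
    by have /(congr1 (fun q => tH q x)) := E i; rewrite !mkH.
  + have [[i x] /= ->] := coverS ee ce a.
    by have /(congr1 (fun q => tS q x)) := E i; rewrite !mkS.
- move=> p P P' _ _ RP RP'; apply/ffunP => i.
  by apply: (comp3_injr (ef i)); rewrite -RP -RP'.
Qed.

End ProdIsos.

(** * Functoriality of the contraction *)

Record valid_spec (G : graph2) : Prop := ValidSpec {
  val_iota : involutive (giota G);
  val_s1 : involutive (gs1 G);
  val_s1N : forall s, gs1 G s != s;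
  val_nus1 : forall s, gnu G (gmu G (gs1 G s)) = gnu G (gmu G s);
  val_s2 : involutive (gs2 G);
  val_mus2 : forall s, giota G (gmu G s) = gmu G (gs2 G s);
  val_fix : forall s, (gs2 G s == s) = (giota G (gmu G s) == gmu G s) }.

Lemma validP G : reflect (valid_spec G) (valid2 G).
Proof.
apply: (iffP and5P).
  move=> [/forallP a /forallP b /forallP c /forallP d].
  move=> /and3P[/forallP e /forallP f /forallP g].
  by split=> s; [exact/eqP|exact/eqP|exact: c|exact/eqP|exact/eqP|exact/eqP|
    exact: (eqP (g s))].
move=> [a b c d e f g]; split; try (by apply/forallP => s; apply/eqP).
  by apply/forallP.
by apply/and3P; split; apply/forallP => s; apply/eqP.
Qed.

Lemma emb_valid X Y (f : tri X Y) : emb f -> valid2 Y -> valid2 X.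
Proof.
move=> ef /validP[a b c d e g h]; apply/validP; split.
- by move=> x; apply: (emb_injH ef); rewrite !(emb_iota ef) a.
- by move=> x; apply: (emb_injS ef); rewrite !(emb_s1 ef) b.
- by move=> x; rewrite -(inj_eq (emb_injS ef)) (emb_s1 ef).
- move=> x; apply: (emb_injV ef).
  by rewrite !(emb_nu ef) !(emb_mu ef) (emb_s1 ef) d.
- by move=> x; apply: (emb_injS ef); rewrite !(emb_s2 ef) e.
- move=> x; apply: (emb_injH ef).
  by rewrite (emb_iota ef) !(emb_mu ef) (emb_s2 ef) g.
- move=> x; rewrite -(inj_eq (emb_injS ef)) -(inj_eq (emb_injH ef)).
  by rewrite (emb_s2 ef) (emb_iota ef) (emb_mu ef) h.
Qed.

Section Contraction.
Variables (G : graph2) (E : {set gH G}).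

Definition cls (x : gV G) : cV E :=
  exist (fun C => C \in comps E) (comp_of E x)
    (imset_f (comp_of E) (in_setT x)).

Lemma clsP (C : cV E) : exists x, C = cls x.
Proof.
case: C => C CE; have /imsetP[x _ xE] := CE.
by exists x; apply: val_inj.
Qed.

Lemma adjE_sym : symmetric (adjE E).
Proof. by move=> x y; rewrite /adjE orbC. Qed.

Lemma cls_eq x y : cls x = cls y <-> connect (adjE E) x y.
Proof.
split=> [/(congr1 val) /= /setP/(_ y)|xy].
  by rewrite !inE connect0 => ->.
apply: val_inj => /=; apply/setP => z; rewrite !inE.
exact: (same_connect (sym_connect_sym adjE_sym)).
Qed.

Definition face_stop (s : gS G) (i : nat) : bool :=
  let t x := s2E E (gs1 G x) in s2E E (gs1 G (iter i t s)) == gs1 G (iter i t s).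

(** The search in [face_end] runs over finitely many indices only; the bound on [k] guarantees that
    [find] meets the first stop instead of running off the list. *)
Lemma face_endE s k : (k < #|gS G|)%N -> face_stop s k ->
  (forall j, (j < k)%N -> ~~ face_stop s j) ->
  face_end E s = gs1 G (iter k (fun x => s2E E (gs1 G x)) s).
Proof.
move=> kn stop first; rewrite /face_end; congr (gs1 G (iter _ _ _)).
have has_k : has (face_stop s) (iota 0 #|gS G|).
  by apply/hasP; exists k => //; rewrite mem_iota add0n.
have lt := has_k; rewrite has_find size_iota in lt.
have := nth_find 0 has_k; rewrite nth_iota // add0n => stop'.
rewrite -/(face_stop s); have [lt'|gt|//] := ltngtP (find (face_stop s) (iota 0 #|gS G|)) k.
  by have := first _ lt'; rewrite stop'.
by have := before_find 0 gt; rewrite nth_iota // add0n stop.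
Qed.

(* The strand sections met from an external one cannot close up into a cycle:
   the predecessor of the external section on such a cycle would be a stop. *)
Lemma face_stopP s : involutive (gs1 G) -> involutive (s2E E) ->
  s2E E s = s ->
  exists k, [/\ (k < #|gS G|)%N, face_stop s k &
    forall j, (j < k)%N -> ~~ face_stop s j].
Proof.
move=> i1 i2 ext; pose t x := s2E E (gs1 G x).
have injt : injective t by move=> x y /(can_inj i2)/(can_inj i1).
have [m] : exists m, (m < #|gS G|)%N && face_stop s m.
  have o0 := order_gt0 t s; exists (order t s).-1; apply/andP; split.
    by rewrite prednK //; apply: max_card.
  have E1 : t (iter (order t s).-1 t s) = s.
    by rewrite -iterS prednK // iter_order.
  rewrite /face_stop -/t; have -> : gs1 G (iter (order t s).-1 t s) = s.
    by rewrite -[LHS]i2 -/(t _) E1.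
  by rewrite ext.
case/andP=> mn stop; have ex : exists m, face_stop s m by exists m.
exists (ex_minn ex); case: ex_minnP => k kstop kmin; split=> //.
  exact: leq_ltn_trans (kmin _ stop) mn.
by move=> j jk; apply: contraL jk => /kmin; rewrite -leqNgt.
Qed.

End Contraction.

Definition core (X : graph2) : graph2 :=
  @Graph2 (gV X) (gH X) (gS X) (gnu X) id (gmu X) (gs1 X) id.

Section ContrEmb.
Variables (X Y : graph2) (E : {set gH X}) (E' : {set gH Y}) (f : tri X Y).
Hypothesis ef : @emb (subg E) (subg E') f.
Hypotheses (i1 : involutive (gs1 X)) (i2 : involutive (s2E E)).
Hypothesis iY : involutive (iotaE E').

Let injV : injective (tV f) := emb_injV ef.
Let injH : injective (tH f) := emb_injH ef.
Let injS : injective (tS f) := emb_injS ef.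
Let f_nu h : tV f (gnu X h) = gnu Y (tH f h) := emb_nu ef h.
Let f_iota h : tH f (iotaE E h) = iotaE E' (tH f h) := emb_iota ef h.
Let f_mu s : tH f (gmu X s) = gmu Y (tS f s) := emb_mu ef s.
Let f_s1 s : tS f (gs1 X s) = gs1 Y (tS f s) := emb_s1 ef s.
Let f_s2 s : tS f (s2E E s) = s2E E' (tS f s) := emb_s2 ef s.

Lemma emb_adj x y : adjE E x y -> adjE E' (tV f x) (tV f y).
Proof.
case/orP=> /existsP[h /andP[/eqP <- /eqP <-]]; apply/orP; [left|right];
  by apply/existsP; exists (tH f h); rewrite !f_nu f_iota !eqxx.
Qed.

Lemma emb_adj_image x z : adjE E' (tV f x) z ->
  exists2 y, z = tV f y & adjE E x y.
Proof.
case/orP=> /existsP[h /andP[/eqP a /eqP b]].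
  have [k kE] : exists k, h = tH f k by apply: (emb_fullH ef (x := x)).
  exists (gnu X (iotaE E k)); first by rewrite f_nu f_iota -kE b.
  apply/orP; left; apply/existsP; exists k; rewrite eqxx andbT.
  by apply/eqP; apply: injV; rewrite f_nu -kE.
(* Here the edge is recorded from its far end, so fullness applies to the partner of [h], and [iY]
   recovers [h] itself. *)
have [k kE] : exists k, iotaE E' h = tH f k by apply: (emb_fullH ef (x := x)).
have hE : h = tH f (iotaE E k) by rewrite f_iota -kE iY.
exists (gnu X (iotaE E k)); first by rewrite f_nu -hE a.
apply/orP; right; apply/existsP; exists (iotaE E k); rewrite eqxx /=.
by apply/eqP; apply: injV; rewrite f_nu f_iota -hE.
Qed.

(** The image of [f] is a union of components: a path that starts in it lifts edge by edge. *)
Lemma emb_connect_image x z : connect (adjE E') (tV f x) z ->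
  exists2 y, z = tV f y & connect (adjE E) x y.
Proof.
case/connectP=> p; elim: p x => [|a p IH] x /=.
  by move=> _ ->; exists x.
case/andP=> /emb_adj_image[y -> xy] /IH{}IH /IH[w -> yw].
by exists w => //; apply: connect_trans yw; apply: connect1.
Qed.

Lemma emb_connect x y : connect (adjE E') (tV f x) (tV f y) <-> connect (adjE E) x y.
Proof.
split=> [/emb_connect_image[z /injV <-] //|].
case/connectP=> p; elim: p x => [|a p IH] x /=; first by move=> _ ->.
case/andP=> /emb_adj xa /IH{}IH /IH; apply: connect_trans; exact: connect1.
Qed.

(** The walk along the face commutes with [f], and injectivity makes both walks stop at the same
    index, which stays within the search bound since [Y] has at least as many strand sections as
    [X]. *)
Lemma emb_face_end s : s2E E s = s -> face_end E' (tS f s) = tS f (face_end E s).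
Proof.
move=> ext; have [k [kn stop first]] := face_stopP i1 i2 ext.
have iterE i : iter i (fun x => s2E E' (gs1 Y x)) (tS f s) =
    tS f (iter i (fun x => s2E E (gs1 X x)) s).
  by elim: i => //= i ->; rewrite f_s2 f_s1.
have stopE i : face_stop E' (tS f s) i = face_stop E s i.
  by rewrite /face_stop iterE -f_s1 -f_s2 (inj_eq injS).
rewrite (face_endE kn stop first) f_s1 -iterE; apply: face_endE.
- exact: leq_trans kn (leq_card _ injS).
- by rewrite stopE.
- by move=> j jk; rewrite stopE; apply: first.
Qed.

(** The embedding controls only the edges in [E] and [E']; the remaining ones become the edges of
    the contractions, which is why the conclusion concerns the cores. *)
Lemma contr_emb : exists g : tri (core (contr E)) (core (contr E')),
  [/\ emb g, forall x, tV g (cls E x) = cls E' (tV f x),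
    forall h, val (tH g h) = tH f (val h) & forall s, val (tS g s) = tS f (val s)].
Proof.
have extH h : (iotaE E' (tH f h) == tH f h) = (iotaE E h == h).
  by rewrite -f_iota (inj_eq injH).
have extS s : (s2E E' (tS f s) == tS f s) = (s2E E s == s).
  by rewrite -f_s2 (inj_eq injS).
have /fin_all_exists[gV gVE] : forall C : cV E, exists C' : cV E',
    forall x, C = cls E x -> C' = cls E' (tV f x).
  move=> C; have [x ->] := clsP C; exists (cls E' (tV f x)) => y.
  by move/cls_eq/emb_connect/cls_eq.
have /fin_all_exists[gH gHE] : forall h : cH E, exists h' : cH E',
    val h' = tH f (val h).
  move=> [h hE]; have hE' : iotaE E' (tH f h) == tH f h by rewrite extH.
  by exists (exist (fun h => iotaE E' h == h) _ hE').
have /fin_all_exists[gS gSE] : forall s : cS E, exists s' : cS E',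
    val s' = tS f (val s).
  move=> [s sE]; have sE' : (s2E E' (tS f s) == tS f s) &&
    (iotaE E' (gmu Y (tS f s)) == gmu Y (tS f s)) by rewrite -f_mu extS extH.
  by exists (exist (fun s => (s2E E' s == s) && (iotaE E' (gmu Y s) == gmu Y s)) _ sE').
have gVc x : gV (cls E x) = cls E' (tV f x) by apply: gVE.
exists (mktri (gV : Defs.gV (core (contr E)) -> Defs.gV (core (contr E')))
  (gH : Defs.gH (core (contr E)) -> Defs.gH (core (contr E')))
  (gS : Defs.gS (core (contr E)) -> Defs.gS (core (contr E')))).
split; try by move=> x; rewrite ?mkV ?mkH ?mkS.
split.
- move=> C D; rewrite !mkV; have [x ->] := clsP C; have [y ->] := clsP D.
  by rewrite !gVc => /cls_eq/emb_connect/cls_eq.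
- move=> h k; rewrite !mkH => /(congr1 val); rewrite !gHE => /injH; exact: val_inj.
- move=> h k; rewrite !mkS => /(congr1 val); rewrite !gSE => /injS; exact: val_inj.
- move=> h; rewrite mkV mkH /= -!/(cls _ _) gVc.
  by apply: val_inj; rewrite /= gHE f_nu.
- by move=> h; rewrite !mkH.
- by move=> s; rewrite mkH mkS; apply: val_inj; rewrite /= gHE gSE /= f_mu.
- move=> s; rewrite !mkS; apply: val_inj; rewrite gSE /= gSE.
  have ext : s2E E (val s) = val s by apply/eqP; case/andP: (valP s).
  rewrite emb_face_end //.
  (* The far end of the face is external on both sides or on neither; in the second case both
     [odflt] fall back to the starting section, and these correspond under [f]. *)
  case: (insubP (cS E)) => [u uP uE|uN].
    rewrite /= uE; rewrite insubT //=; last by rewrite extS -f_mu extH.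
  rewrite insubN ?gSE //=; first by rewrite extS -f_mu extH.
- by move=> s; rewrite !mkS.
- move=> C h; rewrite mkV => hE; have [x CE] := clsP C.
  have /cls_eq/emb_connect_image[y yE _] :
      cls E' (tV f x) = cls E' (gnu Y (val h)) by rewrite -gVc -CE.
  have [k kE] : exists k, val h = tH f k by apply: (emb_fullH ef (x := y)).
  have kext : iotaE E k == k by rewrite -extH -kE (valP h).
  by exists (exist (fun h => iotaE E h == h) k kext); rewrite mkH; apply: val_inj; rewrite gHE.
- move=> h s; rewrite mkH => /(congr1 val); rewrite gHE => hE.
  have [k kE] : exists k, val s = tS f k by apply: (emb_fullS ef (h := val h)).
  have kext : (s2E E k == k) && (iotaE E (gmu X k) == gmu X k).
    by rewrite -extS -extH f_mu -kE (valP s).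
  by exists (exist (fun s => (s2E E s == s) && (iotaE E (gmu X s) == gmu X s)) k kext);
    rewrite mkS; apply: val_inj; rewrite gSE.
Qed.

End ContrEmb.

(** * Boundaries, restrictions and disjoint unions *)

(** A 1-graph seen as a 2-graph with one vertex and no edges: its vertices become half-edges, its
    half-edges become strand sections, and its involution becomes sigma_1. Isomorphisms of 1-graphs
    then fall under the theory of embeddings. *)
Definition star (g : graph1) : graph2 :=
  @Graph2 unit (V1 g) (H1 g) (fun=> tt) id (@nu1 g) (@iota1 g) id.

Definition isos1 (g g' : graph1) :=
  [set p : {ffun V1 g -> V1 g'} * {ffun H1 g -> H1 g'} | is_iso1 p.1 p.2].

Lemma iso1bE g g' : iso1b g g' = (0 < #|isos1 g g'|)%N.
Proof.
rewrite card_gt0; apply/existsP/set0Pn.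
  by move=> [a /existsP[b i]]; exists (a, b); rewrite inE.
by move=> [[a b]]; rewrite inE /= => i; exists a; apply/existsP; exists b.
Qed.

(** The vertex component of an isomorphism of stars is the only map of [unit] to itself, so the
    other two components carry all the data. *)
Lemma card_isos1 g g' : #|isos1 g g'| = #|isos (star g) (star g')|.
Proof.
pose R (q : {ffun V1 g -> V1 g'} * {ffun H1 g -> H1 g'})
  (f : tri (star g) (star g')) := q = (tH f, tS f).
have bijtt (f : {ffun unit -> unit}) : bijb f.
  by apply/bijbP; exists (fun=> tt) => -[]; rewrite //; case: (f tt).
have isoE q : (q \in isos1 g g') =
    (([ffun=> tt], q.1, q.2) \in isos (star g) (star g')).
  rewrite !inE /is_iso1 /is_iso2 /= bijtt /=.
  do 2 congr andb.
  have refl (S T : finType) (f g0 : {ffun S -> T}) : f =1 g0 -> [forall x, f x == g0 x].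
    by move=> E; apply/forallP => x; rewrite E.
  have -> : [forall h : V1 g, ([ffun=> tt] : {ffun unit -> unit}) tt == tt].
    by apply/forallP => h; rewrite ffunE.
  by rewrite !refl //= andbT.
apply: (eq_card_rel (R := R)).
- by move=> q qi; exists ([ffun=> tt], q.1, q.2); rewrite -?isoE //; case: q {qi}.
- move=> f fi; exists (tH f, tS f) => //; rewrite isoE /=.
  suff -> : ([ffun=> tt], tH f : {ffun _ -> _}, tS f : {ffun _ -> _}) = f by [].
  by apply: (@tri_eq (star g) (star g')) => //; case; case: (tV f _); case: (tV _ _).
- by move=> q q' f _ _ -> ->.
- move=> q f f' _ _ -> [/ffunP eH /ffunP eS]; apply: tri_eq => // x.
  by case: (tV f _); case: (tV f' _).
Qed.

Lemma card_isos_star g g' :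
  #|isos (star g) (star g')| = (iso1b g g' * aut1 g')%N.
Proof.
rewrite card_isos iso2bE iso1bE card_isos1.
by rewrite -[aut2 _](card_isos1 g' g').
Qed.

Definition star_tri X (v : gV X) : tri (star (vgraph v)) (core X) :=
  @mktri (star (vgraph v)) (core X) (fun=> v) val val.

(** With all edges cut, each vertex together with what is attached to it is a component by itself;
    the hypothesis keeps sigma_1 inside it, so the [odflt] default never occurs. *)
Lemma star_emb X (v : gV X) :
  (forall s, gnu X (gmu X (gs1 X s)) = gnu X (gmu X s)) -> emb (star_tri v).
Proof.
move=> Xs1; split.
- by move=> [] [].
- by move=> h k; rewrite !mkH; apply: val_inj.
- by move=> h k; rewrite !mkS; apply: val_inj.
- by move=> h; rewrite mkV mkH /= (eqP (valP h)).
- by move=> h; rewrite !mkH.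
- by move=> h; rewrite mkH mkS.
- move=> s; rewrite !mkS /= insubT //; last by rewrite /= Xs1 (valP s).
- by move=> s; rewrite !mkS.
- move=> x h; rewrite mkV => /esym/eqP hE.
  by exists (exist (fun h => gnu X h == v) h hE); rewrite mkH.
- move=> h s; rewrite mkH => hE.
  have sE : gnu X (gmu X s) == v by rewrite -hE (valP h).
  by exists (exist (fun s => gnu X (gmu X s) == v) s sE); rewrite mkS.
Qed.

Lemma iotaE_all G h : iotaE (all_edges G) h = giota G h.
Proof. by rewrite /iotaE inE; case: eqP => //= ->. Qed.

Lemma s2E_all G s : valid2 G -> s2E (all_edges G) s = gs2 G s.
Proof.
move=> /validP vG; rewrite /s2E inE -(val_fix vG).
by case: eqP => //= ->.
Qed.

Notation rsd G := (contr (all_edges G)).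

Lemma emb_all X Y (f : tri X Y) : valid2 X -> valid2 Y -> emb f ->
  @emb (subg (all_edges X)) (subg (all_edges Y)) f.
Proof.
move=> vX vY [a b c d e g h i j k]; split=> //.
  move=> x; rewrite -[giota _ _]/(iotaE _ _) -[giota _ _ in RHS]/(iotaE _ _).
  by rewrite !iotaE_all; apply: e.
move=> x; rewrite -[gs2 _ _]/(s2E _ _) -[gs2 _ _ in RHS]/(s2E _ _).
by rewrite !s2E_all //; apply: i.
Qed.

Lemma rsd_emb X Y (f : tri X Y) : valid2 X -> valid2 Y -> emb f ->
  exists2 g : tri (core (rsd X)) (core (rsd Y)), emb g &
    forall x, tV g (cls _ x) = cls _ (tV f x).
Proof.
move=> vX vY ef; have [] := contr_emb (emb_all vX vY ef).
- by case/validP: vX.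
- by move=> s; rewrite !s2E_all //; case/validP: vX.
- by move=> h; rewrite !iotaE_all; case/validP: vY.
- by move=> g [eg gV _ _]; exists g.
Qed.

Lemma emb_card X Y (f : tri X Y) : emb f ->
  [/\ (#|gV X| <= #|gV Y|)%N, (#|gH X| <= #|gH Y|)%N & (#|gS X| <= #|gS Y|)%N].
Proof.
by move=> ef; split;
  [exact: leq_card (emb_injV ef)|exact: leq_card (emb_injH ef)|
   exact: leq_card (emb_injS ef)].
Qed.

Lemma iso_card X Y (f : tri X Y) : f \in isos X Y ->
  [/\ #|gV X| = #|gV Y|, #|gH X| = #|gH Y| & #|gS X| = #|gS Y|].
Proof.
move=> fi; have [g gi _] := iso_inv fi.
have /isosP[/emb_card[a b c] _] := fi; have /isosP[/emb_card[a' b' c'] _] := gi.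
by split; apply/eqP; rewrite eqn_leq ?a ?a' ?b ?b' ?c ?c'.
Qed.

(** A star has one vertex, so an isomorphism forces [T] to be connected. The core of the residue is
    then the star of its unique vertex graph, which is the boundary. *)
Lemma card_isos_rsd_star T g :
  #|isos (core (rsd T)) (star g)| = ((connected2 T && iso1b (bdry T) g) * aut1 g)%N.
Proof.
have cardV : #|gV (rsd T)| = #|comps (all_edges T)|.
  by rewrite card_sig.
have [conn|nconn] := boolP (connected2 T); last first.
  rewrite mul0n; apply: eq_card0 => f; apply: contraNF nconn => /iso_card[+ _ _].
  by rewrite [LHS]cardV card_unit /connected2 => ->.
have oneV (x y : gV (rsd T)) : x = y.
  by apply: (@fintype_le1P (gV (rsd T)) _); rewrite ?cardV ?(eqP conn).
rewrite /= /bdry; case: pickP => [v _|/eq_card0]; last first.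
  by rewrite cardT -cardE cardV (eqP conn).
rewrite -card_isos_star; apply/esym; apply: (@card_isos_l _ _ _ (star_tri v)).
apply/isosP; split; first by apply: star_emb => s; apply: oneV.
by move=> y; exists tt; rewrite mkV; apply: oneV.
Qed.

Section Restriction.
Variables (A : graph2) (I : finType) (c : gV A -> I).
Hypotheses (vA : valid2 A) (ciota : forall h, c (gnu A (giota A h)) = c (gnu A h)).

(** The part of [A] of colour [v]. As [ciota] says that edges preserve colours, the involutions
    restrict to it and, for valid [A], the [odflt] defaults are never reached. *)
Definition restr (v : I) : graph2 :=
  @Graph2 {x | c x == v} {h | c (gnu A h) == v} {s | c (gnu A (gmu A s)) == v}
    (fun h => exist (fun x => c x == v) (gnu A (val h)) (valP h))
    (fun h => odflt h (insub (giota A (val h))))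
    (fun s => exist (fun h => c (gnu A h) == v) (gmu A (val s)) (valP s))
    (fun s => odflt s (insub (gs1 A (val s))))
    (fun s => odflt s (insub (gs2 A (val s)))).

Definition restr_tri (v : I) : tri (restr v) A := @mktri (restr v) A val val val.

Lemma restr_emb v : emb (restr_tri v).
Proof.
have [vi v1 v1N vn1 v2 vm2 vf] := validP _ vA; split.
- by move=> h k; rewrite !mkV; apply: val_inj.
- by move=> h k; rewrite !mkH; apply: val_inj.
- by move=> h k; rewrite !mkS; apply: val_inj.
- by move=> h; rewrite mkV mkH.
- by move=> h; rewrite !mkH /= insubT //; rewrite /= ciota (valP h).
- by move=> h; rewrite mkH mkS.
- by move=> s; rewrite !mkS /= insubT //; rewrite /= vn1 (valP s).
- by move=> s; rewrite !mkS /= insubT //; rewrite /= -vm2 ciota (valP s).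
- move=> x h; rewrite mkV => xE.
  have hE : c (gnu A h) == v by rewrite -xE (valP x).
  by exists (exist (fun h => c (gnu A h) == v) h hE); rewrite mkH.
- move=> h s; rewrite mkH => hE.
  have sE : c (gnu A (gmu A s)) == v by rewrite -hE (valP h).
  by exists (exist (fun s => c (gnu A (gmu A s)) == v) s sE); rewrite mkS.
Qed.

Lemma restr_cover : covers restr_tri.
Proof.
split=> [v w x y|y].
  by rewrite !mkV => xy; rewrite -(eqP (valP x)) -(eqP (valP y)) xy.
exists (c y), (exist (fun x => c x == c y) y (eqxx _)).
by rewrite mkV.
Qed.

End Restriction.

Section DisjointUnion.
Variables (I : finType) (F : I -> graph2).

Definition inj_tri (i : I) : tri (F i) (dunion F) :=
  @mktri (F i) (dunion F) (fun x => existT _ i x) (fun x => existT _ i x)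
    (fun x => existT _ i x).

Lemma inj_emb i : emb (inj_tri i).
Proof.
have inj (T : I -> finType) (x y : T i) :
  existT (fun i => T i) i x = existT (fun i => T i) i y -> x = y.
  by move/eqP; rewrite eq_Tagged => /eqP.
split.
- by move=> x y; rewrite !mkV; apply: (inj (fun i => gV (F i))).
- by move=> x y; rewrite !mkH; apply: (inj (fun i => gH (F i))).
- by move=> x y; rewrite !mkS; apply: (inj (fun i => gS (F i))).
- by move=> h; rewrite mkV mkH.
- by move=> h; rewrite !mkH.
- by move=> h; rewrite mkH mkS.
- by move=> h; rewrite !mkS.
- by move=> h; rewrite !mkS.
- move=> x [j h]; rewrite mkV => E; have ij : i = j := congr1 tag E.
  by case: j / ij h {E} => h; exists h; rewrite mkH.
- move=> x [j h]; rewrite mkH => E; have ij : i = j := congr1 tag E.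
  by case: j / ij h {E} => h; exists h; rewrite mkS.
Qed.

Lemma inj_cover : covers inj_tri.
Proof.
split=> [i j x y|[i x]]; first by rewrite !mkV => /(congr1 tag).
by exists i, x; rewrite mkV.
Qed.

End DisjointUnion.

Lemma cover_comp (I : finType) (X : I -> graph2) A B
    (e : forall i, tri (X i) A) (p : tri A B) :
  p \in isos A B -> covers e -> covers (fun i => comp3 p (e i)).
Proof.
move=> /isosP[ep sp] [de ce]; split=> [i j x y|b].
  by rewrite !mkV => /(emb_injV ep); apply: de.
have [a ->] := sp b; have [i [x ->]] := ce a.
by exists i, x; rewrite mkV.
Qed.

Lemma emb_core X Y (f : tri X Y) : emb f -> @emb (core X) (core Y) f.
Proof. by case. Qed.

(** * Labelled 2-graphs *)

(** Convertible to [tri (ograph d) G] for every [d], so that one labelling can be tested against all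
    labelled structures [d]. *)
Definition lab (a b c : nat) (G : graph2) : finType :=
  ({ffun 'I_a -> gV G} * {ffun 'I_b -> gH G} * {ffun 'I_c -> gS G})%type.

Definition bijs a b c (G : graph2) : {set lab a b c G} :=
  [set p : lab a b c G | [&& bijb p.1.1, bijb p.1.2 & bijb p.2]].

Definition fact3 (a b c : nat) : nat := (a`! * b`! * c`!)%N.

Lemma fact3_neq0 a b c : ((fact3 a b c)%:R : rat) != 0%R.
Proof. by rewrite pnatr_eq0 -lt0n !muln_gt0 !fact_gt0. Qed.

Lemma card_bijb (S T : finType) : #|S| = #|T| ->
  #|[set f : {ffun S -> T} | bijb f]| = (#|T|)`!.
Proof.
move=> ST; rewrite -[RHS]ffactnn -{2}ST -card_inj_ffuns.
apply: eq_card => f; rewrite !inE; apply/bijbP/injectiveP => [|fi].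
  exact: bij_inj.
by apply: inj_card_bij => //; rewrite ST.
Qed.

Lemma card_bijs a b c G : #|gV G| = a -> #|gH G| = b -> #|gS G| = c ->
  #|bijs a b c G| = fact3 a b c.
Proof.
move=> Ga Gb Gc.
have -> : bijs a b c G = setX (setX [set f | bijb f] [set f | bijb f]) [set f | bijb f].
  by apply/setP => -[[x y] z]; rewrite !inE andbA.
rewrite !cardsX !card_bijb ?card_ord //.
by rewrite Ga Gb Gc.
Qed.

Section Labelling.
Variables (a b c : nat) (G : graph2).
Implicit Types (d : Raw a b c) (p : lab a b c G).

Lemma isos_bijs d p : p \in isos (ograph d) G -> p \in bijs a b c G.
Proof. by rewrite !inE => /and5P[-> -> -> _ _]. Qed.

Lemma label_exists p : p \in bijs a b c G ->
  exists d, p \in isos (ograph d) G.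
Proof.
rewrite inE => /and3P[b1 b2 b3].
have [g1 f1 k1] := bijbP _ b1; have [g2 f2 k2] := bijbP _ b2.
have [g3 f3 k3] := bijbP _ b3.
exists ([ffun h => g1 (gnu G (p.1.2 h))], [ffun h => g2 (giota G (p.1.2 h))],
  [ffun s => g2 (gmu G (p.2 s))], [ffun s => g3 (gs1 G (p.2 s))],
  [ffun s => g3 (gs2 G (p.2 s))]).
rewrite inE /is_iso2 b1 b2 b3 /=; apply/and5P.
by split; apply/forallP => x; rewrite ffunE ?k1 ?k2 ?k3.
Qed.

Lemma label_unique d d' p :
  p \in isos (ograph d) G -> p \in isos (ograph d') G -> d = d'.
Proof.
move=> /isosP[e _] /isosP[e' _].
case: d d' e e' => [[[[d1 d2] d3] d4] d5] [[[[d1' d2'] d3'] d4'] d5'] e e'.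
have -> : d1 = d1'.
  by apply/ffunP => h; apply: (emb_injV e); rewrite [LHS](emb_nu e) [RHS](emb_nu e').
have -> : d2 = d2'.
  by apply/ffunP => h; apply: (emb_injH e); rewrite [LHS](emb_iota e) [RHS](emb_iota e').
have -> : d3 = d3'.
  by apply/ffunP => h; apply: (emb_injH e); rewrite [LHS](emb_mu e) [RHS](emb_mu e').
have -> : d4 = d4'.
  by apply/ffunP => h; apply: (emb_injS e); rewrite [LHS](emb_s1 e) [RHS](emb_s1 e').
have -> // : d5 = d5'.
by apply/ffunP => h; apply: (emb_injS e); rewrite [LHS](emb_s2 e) [RHS](emb_s2 e').
Qed.

(** Transport of structure: each triple of bijections onto [G] is an isomorphism from exactly one
    labelled 2-graph. *)
Lemma sum_isos_labels :
  (\sum_(d : Raw a b c) #|isos (ograph d) G|)%N = #|bijs a b c G|.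
Proof.
transitivity (\sum_(d : Raw a b c) \sum_(p : lab a b c G | p \in isos (ograph d) G) 1)%N.
  by apply: eq_bigr => d _; rewrite sum1_card.
rewrite (exchange_big_dep (mem (bijs a b c G))) /=; last first.
  by move=> d p _; apply: isos_bijs.
rewrite -sum1_card; apply: eq_bigr => p /label_exists[d di].
rewrite (big_pred1 d) // => d'; apply/idP/eqP => [d'i|-> //].
exact: label_unique d'i di.
Qed.

End Labelling.

(** Orbit-stabiliser: in the count of labellings of [ograph d], each member of the class contributes
    one copy of the automorphism group. *)
Lemma card_class a b c (d : Raw a b c) :
  (#|[set d' : Raw a b c | iso2b (ograph d') (ograph d)]| * aut2 (ograph d))%N
  = fact3 a b c.
Proof.
rewrite -(@card_bijs a b c (ograph d)) ?card_ord // -sum_isos_labels.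
rewrite -sum1_card big_distrl big_mkcond /=; apply: eq_bigr => d' _.
by rewrite card_isos inE; case: ifP.
Qed.

Section Boxes.
Variables a b c : nat.

(** Isomorphic graphs have equal sizes, so only the stratum of size [n] contributes and the weight
    [w] is constant on it. *)
Lemma sum_box (G : graph2) (n : 'I_a.+1 * 'I_b.+1 * 'I_c.+1)
    (w : 'I_a.+1 * 'I_b.+1 * 'I_c.+1 -> rat) :
  #|gV G| = n.1.1 -> #|gH G| = n.1.2 -> #|gS G| = n.2 ->
  (\sum_(y : Box a b c) (#|isos (oG y) G|)%:R * w (tag y)
   = (fact3 n.1.1 n.1.2 n.2)%:R * w n)%R.
Proof.
move=> n1 n2 n3; pose F (m : 'I_a.+1 * 'I_b.+1 * 'I_c.+1) (d : Raw m.1.1 m.1.2 m.2) : rat :=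
  ((#|isos (ograph d) G|)%:R * w m)%R.
rewrite -(sig_big_dep xpredT (fun=> xpredT) F) /= (bigD1 n) //= [X in (_ + X)%R]big1 ?addr0.
  rewrite /F -mulr_suml -natr_sum sum_isos_labels card_bijs //.
move=> m mn; apply: big1 => d _; rewrite /F; case: (set_0Vmem (isos (ograph d) G)).
  by move=> ->; rewrite cards0 mul0r.
move=> [p /iso_card]; rewrite n1 n2 n3 !card_ord => -[e1 e2 e3].
case/eqP: mn; case: m n e1 e2 e3 {n1 n2 n3 F d p} => [[m1 m2] m3] [[k1 k2] k3] /=.
by move=> /val_inj-> /val_inj-> /val_inj->.
Qed.

Definition boxfact (x : Box a b c) : nat :=
  fact3 (tag x).1.1 (tag x).1.2 (tag x).2.

Lemma clsz_aut (x : Box a b c) : (clsz x * aut2 (oG x))%N = boxfact x.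
Proof.
apply/eqP; rewrite -(eqr_nat rat); apply/eqP.
have := @sum_box (oG x) (tag x) (fun=> 1%R).
rewrite !card_ord mulr1 => <- //.
rewrite /clsz -sum1_card big_distrl big_mkcond /= natr_sum; apply: eq_bigr => y _.
by rewrite card_isos inE mulr1; case: ifP.
Qed.

(** Dividing by the number of labellings counts the class of [G] once; the bounds ensure that the
    box contains its size. *)
Lemma sum_box_weighted (G : graph2) :
  (#|gV G| <= a)%N -> (#|gH G| <= b)%N -> (#|gS G| <= c)%N ->
  (\sum_(y : Box a b c) (boxfact y)%:R^-1 * (#|isos (oG y) G|)%:R = 1 :> rat)%R.
Proof.
move=> n1 n2 n3; rewrite -ltnS in n1; rewrite -ltnS in n2; rewrite -ltnS in n3.
pose n := (Ordinal n1, Ordinal n2, Ordinal n3).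
have := @sum_box G n (fun m => (fact3 m.1.1 m.1.2 m.2)%:R^-1)%R erefl erefl erefl.
rewrite mulfV ?fact3_neq0 // => E; rewrite -[RHS]E; apply: eq_bigr => y _.
by rewrite mulrC.
Qed.

End Boxes.

(** * The coefficients of the coproduct *)

Section EdgeSet.
Variables (X : graph2) (E : {set gH X}).
Hypotheses (vX : valid2 X) (EE : edgeset E).

Lemma edgesetP h : h \in E -> giota X h != h /\ giota X h \in E.
Proof. by move: EE => /forallP/(_ h)/implyP H /H/andP. Qed.

Lemma edgeset_iota h : (giota X h \in E) = (h \in E).
Proof.
by apply/idP/idP => /edgesetP[_] //; case/validP: vX => ->.
Qed.

Lemma edgeset_mus2 s : (gmu X (gs2 X s) \in E) = (gmu X s \in E).
Proof. by case/validP: vX => _ _ _ _ _ <- _; rewrite edgeset_iota. Qed.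

Lemma iotaE_ext h : (iotaE E h == h) = (h \notin E).
Proof.
rewrite /iotaE; case: ifP => [/edgesetP[/negbTE] //|_]; exact: eqxx.
Qed.

Lemma s2E_ext s : (s2E E s == s) && (iotaE E (gmu X s) == gmu X s) = (gmu X s \notin E).
Proof.
by rewrite iotaE_ext /s2E; case: ifP => _ /=; rewrite ?andbF ?eqxx.
Qed.

Lemma s2E_inv : involutive (s2E E).
Proof.
move=> s; rewrite /s2E; case: (boolP (gmu X s \in E)) => sE.
  by rewrite edgeset_mus2 sE; case/validP: vX => _ _ _ _ ->.
by rewrite (negbTE sE).
Qed.

Lemma contr_iota (h : gH (contr E)) : val (giota (contr E) h) = giota X (val h).
Proof.
rewrite /= insubT //; rewrite /= iotaE_ext edgeset_iota.
by rewrite -iotaE_ext (valP h).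
Qed.

Lemma contr_s2 (s : gS (contr E)) : val (gs2 (contr E) s) = gs2 X (val s).
Proof.
rewrite /= insubT //; rewrite /= s2E_ext edgeset_mus2.
by rewrite -s2E_ext (valP s).
Qed.
End EdgeSet.

Lemma edgeset_all G : valid2 G -> edgeset (all_edges G).
Proof.
move=> /validP vG; apply/forallP => h; apply/implyP; rewrite !inE => hE.
by rewrite hE (val_iota vG) eq_sym.
Qed.

(* [r] is compatible with [p] when it carries the involutions [giota] and [gs2]
   of [X], read on the external part of [A] through [p], to those of [B]. *)
Definition compat X A B (p : tri X A) (r : tri (core (rsd A)) (core B)) : bool :=
  [forall h, forall k : gH (rsd A), forall k' : gH (rsd A),
     (tH p h == val k) && (tH p (giota X h) == val k')
     ==> (tH r k' == giota B (tH r k))] &&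
  [forall s, forall u : gS (rsd A), forall u' : gS (rsd A),
     (tS p s == val u) && (tS p (gs2 X s) == val u')
     ==> (tS r u' == gs2 B (tS r u))].

Lemma compatP X A B (p : tri X A) (r : tri (core (rsd A)) (core B)) :
  reflect
  ((forall h (k k' : gH (rsd A)), tH p h = val k -> tH p (giota X h) = val k' ->
     tH r k' = giota B (tH r k)) /\
   (forall s (u u' : gS (rsd A)), tS p s = val u -> tS p (gs2 X s) = val u' ->
     tS r u' = gs2 B (tS r u)))
  (compat p r).
Proof.
apply: (iffP andP) => -[a b]; split.
- move=> h k k' e e'; have /forallP/(_ k)/forallP/(_ k')/implyP := forallP a h.
  by rewrite e e' !eqxx => /(_ isT)/eqP.
- move=> h k k' e e'; have /forallP/(_ k)/forallP/(_ k')/implyP := forallP b h.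
  by rewrite e e' !eqxx => /(_ isT)/eqP.
- apply/forallP => h; apply/forallP => k; apply/forallP => k'; apply/implyP.
  by move=> /andP[/eqP e /eqP e']; apply/eqP; apply: a e e'.
- apply/forallP => h; apply/forallP => k; apply/forallP => k'; apply/implyP.
  by move=> /andP[/eqP e /eqP e']; apply/eqP; apply: b e e'.
Qed.

Lemma emb_subg_all X (E : {set gH X}) A (p : tri X A) : valid2 A ->
  @emb (subg E) A p -> @emb (subg E) (subg (all_edges A)) p.
Proof.
move=> vA [a b c d e g h i j k]; split=> // x.
  by rewrite -[giota _ _ in RHS]/(iotaE _ _) iotaE_all; apply: e.
by rewrite -[gs2 _ _ in RHS]/(s2E _ _) s2E_all //; apply: i.
Qed.

(** Since [p] is onto, [contr_emb] gives an isomorphism [g] from the core of the contraction to the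
    core of the residue of [A]. Composition with [g] matches [q] with [r], and [compat] is exactly
    the condition that [q] respects the edges and edge strands of the contraction. *)
Lemma card_isos_contr X (E : {set gH X}) A B (p : tri X A) :
  valid2 X -> valid2 A -> edgeset E -> p \in isos (subg E) A ->
  #|isos (contr E) B| =
  #|[set r in isos (core (rsd A)) (core B) | compat p r]|.
Proof.
move=> vX vA EE /isosP[ep sp].
have [] := contr_emb (emb_subg_all vA ep).
- by case/validP: vX.
- exact: s2E_inv.
- by move=> h; rewrite !iotaE_all; case/validP: vA.
move=> g [eg gV gH gS].
have sg : surV g.
  move=> C; have [y ->] := clsP C; have [x ->] := sp y.
  by exists (cls E x); rewrite gV.
have gi : g \in isos (core (contr E)) (core (rsd A)) by apply/isosP.
have [g' g'i [cV cH cS]] := iso_inv gi.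
have cV' x : tV g' (tV g x) = x by apply: (emb_injV eg); rewrite cV.
have cH' x : tH g' (tH g x) = x by apply: (emb_injH eg); rewrite cH.
have cS' x : tS g' (tS g x) = x by apply: (emb_injS eg); rewrite cS.
pose R (q : tri (contr E) B) (r : tri (core (rsd A)) (core B)) :=
  q = comp3 r g :> tri (core (contr E)) (core B).
apply: (eq_card_rel (R := R)).
- move=> q /isosP[eq sq].
  have q0 : (q : tri (core (contr E)) (core B)) \in isos (core (contr E)) (core B).
    by apply/isosP; split=> //; apply: emb_core.
  pose r : tri (core (rsd A)) (core B) :=
    @comp3 _ (core (contr E)) _ (q : tri (core (contr E)) (core B)) g'.
  have rV x : tV r (tV g x) = tV q x by rewrite mkV cV'.
  have rH x : tH r (tH g x) = tH q x by rewrite mkH cH'.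
  have rS x : tS r (tS g x) = tS q x by rewrite mkS cS'.
  exists r; last first.
    apply: (@tri_eq (core (contr E)) (core B)) => x.
    - by rewrite [RHS]mkV rV.
    - by rewrite [RHS]mkH rH.
    - by rewrite [RHS]mkS rS.
  rewrite inE; apply/andP; split; first exact: iso_comp q0 g'i.
  apply/compatP; split=> [h k k' hk hk'|s u u' su su'].
    have [[l lE] lk] := emb_surH eg sg k.
    have hl : h = l by apply: (emb_injH ep); rewrite hk lk gH.
    subst l; pose l := exist (fun h => iotaE E h == h) h lE : Defs.gH (contr E).
    have -> : k' = tH g (giota (contr E) l).
      by apply: val_inj; rewrite gH contr_iota //= -hk'.
    by rewrite lk rH rH (emb_iota eq).
  have [[l lE] lu] := emb_surS eg sg u.
  have sl : s = l by apply: (emb_injS ep); rewrite su lu gS.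
  subst l; pose l := exist (fun s => (s2E E s == s) &&
    (iotaE E (gmu X s) == gmu X s)) s lE : Defs.gS (contr E).
  have -> : u' = tS g (gs2 (contr E) l).
    by apply: val_inj; rewrite gS contr_s2 //= -su'.
  by rewrite lu rS rS (emb_s2 eq).
- move=> r; rewrite inE => /andP[ri /compatP[comH comS]].
  exists (comp3 r g) => //.
  have /isosP[ec sc] := iso_comp ri gi.
  apply/isosP; split=> //; case: ec => a b c d _ e f _ h i; split=> //.
    move=> l; rewrite [LHS]mkH [in RHS]mkH; apply: (comH (val l)); rewrite gH //.
    by rewrite contr_iota.
  move=> l; rewrite [LHS]mkS [in RHS]mkS; apply: (comS (val l)); rewrite gS //.
  by rewrite contr_s2.
- by move=> q q' r _ _ -> ->.
- by move=> q r r' _ _ -> /comp3_injl; apply.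
Qed.

(** * Reconstruction of a 2-graph from a subgraph and its contraction *)

Section Insertion.
Variables (A B : graph2) (r : tri (core (rsd A)) (core B)).
Hypotheses (vA : valid2 A) (vB : valid2 B).
Hypothesis ri : r \in isos (core (rsd A)) (core B).

(* The inverse [r'] of [r] is an argument: it is only available under an
   existential. *)
Definition iota_ins (r' : tri (core B) (core (rsd A))) (x : gH A) : gH A :=
  if insub x is Some k then val (tH r' (giota B (tH r (k : gH (rsd A)))))
  else giota A x.
Definition s2_ins (r' : tri (core B) (core (rsd A))) (x : gS A) : gS A :=
  if insub x is Some u then val (tS r' (gs2 B (tS r (u : gS (rsd A)))))
  else gs2 A x.

(** When [r'] is inverse to [r], this is [A] with its external half-edges joined by the edges of
    [B]. *)
Definition ins r' : graph2 :=
  @Graph2 (gV A) (gH A) (gS A) (gnu A) (iota_ins r') (gmu A) (gs1 A) (s2_ins r').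

Lemma extHP (x : gH A) : x \notin all_edges A -> exists k : gH (rsd A), x = val k.
Proof.
rewrite -(iotaE_ext (edgeset_all vA)) => xE.
by exists (exist (fun h => iotaE (all_edges A) h == h) x xE).
Qed.

Lemma extSP (x : gS A) : gmu A x \notin all_edges A -> exists u : gS (rsd A), x = val u.
Proof.
rewrite -(s2E_ext (edgeset_all vA)) => xE.
by exists (exist (fun s => (s2E (all_edges A) s == s) &&
  (iotaE (all_edges A) (gmu A s) == gmu A s)) x xE).
Qed.

Lemma iota_ins_int r' x : x \in all_edges A -> iota_ins r' x = giota A x.
Proof.
by move=> xE; rewrite /iota_ins insubN //= (iotaE_ext (edgeset_all vA)) negbK.
Qed.

Lemma s2_ins_int r' x : gmu A x \in all_edges A -> s2_ins r' x = gs2 A x.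
Proof.
by move=> xE; rewrite /s2_ins insubN //= (s2E_ext (edgeset_all vA)) negbK.
Qed.

Lemma iota_ins_ext r' (k : gH (rsd A)) :
  iota_ins r' (val k) = val (tH r' (giota B (tH r k))).
Proof. by rewrite /iota_ins valK. Qed.

Lemma s2_ins_ext r' (u : gS (rsd A)) :
  s2_ins r' (val u) = val (tS r' (gs2 B (tS r u))).
Proof. by rewrite /s2_ins valK. Qed.

(** The axioms on the new involutions split into two cases: internal elements inherit them from [A],
    external ones from [B] by conjugation with [r]. *)
Lemma ins_valid r' : r' \in isos (core B) (core (rsd A)) ->
  cancel (tH r') (tH r) -> cancel (tS r') (tS r) -> valid2 (ins r').
Proof.
move=> /isosP[er' _] cH cS; have [er sr] := (isosP r).1 ri.
have cH' x : tH r' (tH r x) = x by apply: (emb_injH er); rewrite cH.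
have cS' x : tS r' (tS r x) = x by apply: (emb_injS er); rewrite cS.
have [vi v1 v1N vn1 v2 vm2 vf] := validP _ vA.
have [wi w1 w1N wn1 w2 wm2 wf] := validP _ vB.
have muE (u : gS (rsd A)) : gmu A (val u) = val (gmu (rsd A) u) by [].
apply/validP; split=> //.
- move=> x /=; have [xE|/extHP[k ->]] := boolP (x \in all_edges A).
    by rewrite !iota_ins_int ?(edgeset_iota vA (edgeset_all vA)) // vi.
  by rewrite !iota_ins_ext cH wi cH'.
- move=> x /=; have [xE|/extSP[k ->]] := boolP (gmu A x \in all_edges A).
    by rewrite !s2_ins_int ?(edgeset_mus2 vA (edgeset_all vA)) // v2.
  by rewrite !s2_ins_ext cS w2 cS'.
- move=> x /=; have [xE|/extSP[u ->]] := boolP (gmu A x \in all_edges A).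
    by rewrite s2_ins_int // iota_ins_int // vm2.
  rewrite s2_ins_ext !muE iota_ins_ext; congr val.
  by rewrite -[RHS](emb_mu er') /= -wm2 -[gmu B _](emb_mu er).
- move=> x /=; have [xE|/extSP[u ->]] := boolP (gmu A x \in all_edges A).
    by rewrite s2_ins_int // iota_ins_int // vf.
  rewrite s2_ins_ext !muE iota_ins_ext !(inj_eq val_inj).
  rewrite -(inj_eq (emb_injS er)) -[RHS](inj_eq (emb_injH er)) cS cH.
  by rewrite wf [tH r _](emb_mu er).
Qed.

(* The edges of [E] are those of [A]; the remaining edges are read off from [B]
   through [r]. *)
Lemma insertion_unique a b c (p : lab a b c A) : p \in bijs a b c A ->
  exists d0 E0, forall (d : Raw a b c) (E : {set 'I_b}),
    [&& valid2 (ograph d), @edgeset (ograph d) E,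
        p \in isos (@subg (ograph d) E) A & @compat (ograph d) A B p r]
    = (d == d0) && (E == E0).
Proof.
move=> pb; have [er sr] := (isosP r).1 ri.
have [r' r'i [_ cH cS]] := iso_inv ri.
have cH' x : tH r' (tH r x) = x by apply: (emb_injH er); rewrite cH.
have cS' x : tS r' (tS r x) = x by apply: (emb_injS er); rewrite cS.
have vI := ins_valid r'i cH cS.
have [vi v1 v1N vn1 v2 vm2 vf] := validP _ vA.
(* [d0] is the structure of [ins r'] pulled back along [p], and the edge set is the preimage of the
   edges of [A]. *)
have [d0 d0i] : exists d, p \in isos (ograph d) (ins r').
  exact: (@label_exists a b c (ins r') p).
exists d0, [set h | p.1.2 h \in all_edges A] => d E.
apply/and4P/andP => [[vd EE /isosP[ep sp] /compatP[comH comS]]|[/eqP-> /eqP->]].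
  (* A half-edge lies in [E] iff the subgraph involution moves it, and [p] carries that involution
     to the one of [A]. *)
  have pE h : (h \in E) = (@tH (ograph d) A p h \in all_edges A).
    rewrite inE -(emb_iota ep) (inj_eq (emb_injH ep)).
    by rewrite [_ == h](iotaE_ext EE) negbK.
  split; last by apply/eqP/setP => h; rewrite inE pE.
  (* It remains to see that [p] is an isomorphism onto [ins r']: on [E] because it is one for the
     subgraph, off [E] by compatibility. *)
  apply/eqP; apply: label_unique d0i; apply/isosP; split=> //.
  case: (ep) => q1 q2 q3 q4 q5 q6 q7 q8 q9 q10; split=> //.
    move=> h; have [hE|hE] := boolP (h \in E).
      rewrite [RHS]iota_ins_int -?pE // -[RHS](emb_iota ep) /=.
      by rewrite /iotaE hE.
    have [k kE] : exists k : gH (rsd A), @tH (ograph d) A p h = val k.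
      by apply: extHP; rewrite -pE.
    have [k' k'E] : exists k' : gH (rsd A), @tH (ograph d) A p (giota (ograph d) h) = val k'.
      by apply: extHP; rewrite -pE (edgeset_iota vd EE).
    have := comH _ _ _ kE k'E => /(congr1 (tH r')); rewrite cH' => k'r.
    by rewrite [RHS]/= kE iota_ins_ext -k'r.
  move=> s; have pS u : (gmu (ograph d) u \in E) = (gmu A (@tS (ograph d) A p u) \in all_edges A).
    by rewrite pE (emb_mu ep).
  have [sE|sE] := boolP (gmu (ograph d) s \in E).
    rewrite [RHS]s2_ins_int -?pS // -[RHS](emb_s2 ep) /=.
    by rewrite /s2E sE.
  have [k kE] : exists k : gS (rsd A), @tS (ograph d) A p s = val k.
    by apply: extSP; rewrite -pS.
  have [k' k'E] : exists k' : gS (rsd A), @tS (ograph d) A p (gs2 (ograph d) s) = val k'.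
    by apply: extSP; rewrite -pS (edgeset_mus2 vd EE).
  have := comS _ _ _ kE k'E => /(congr1 (tS r')); rewrite cS' => k'r.
  by rewrite [RHS]/= kE s2_ins_ext -k'r.
have [ep sp] := (isosP _).1 d0i; set E0 := [set h | _].
have pE h : (h \in E0) = (@tH (ograph d0) A p h \in all_edges A) by rewrite inE.
have vd := emb_valid ep vI; have pi := emb_iota ep; have ps := emb_s2 ep.
have EE : @edgeset (ograph d0) E0.
  apply/forallP => h; apply/implyP; rewrite pE => hE.
  rewrite pE pi /= iota_ins_int // (edgeset_iota vA (edgeset_all vA)) hE andbT.
  rewrite -(inj_eq (emb_injH ep)) pi /= iota_ins_int //.
  by rewrite inE in hE.
split=> //.
  apply/isosP; split=> //.
  case: (ep) => q1 q2 q3 q4 q5 q6 q7 q8 q9 q10; split=> //.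
    move=> h; rewrite /= /iotaE pE.
    have [hE|hE] := boolP (@tH (ograph d0) A p h \in all_edges A).
      by rewrite [LHS]pi /= iota_ins_int.
    by rewrite inE negbK in hE; rewrite (eqP hE).
  move=> s; rewrite /= /s2E pE [@tH (ograph d0) A p _](emb_mu ep) /=.
  have [sE|sE] := boolP (gmu A (@tS (ograph d0) A p s) \in all_edges A).
    by rewrite [LHS]ps /= s2_ins_int.
  by rewrite inE negbK -vf in sE; rewrite (eqP sE).
apply/compatP; split=> [h k k' hk|s u u' su].
  rewrite pi /= hk iota_ins_ext => /val_inj <-; exact: cH.
rewrite ps /= su s2_ins_ext => /val_inj <-; exact: cS.
Qed.

End Insertion.

Section LeftSide.
Variables (A B : graph2).
Hypotheses (vA : valid2 A) (vB : valid2 B).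

Definition subcount (G : graph2) : nat :=
  #|[set E : {set gH G} | [&& edgeset E, iso2b (subg E) A & iso2b (contr E) B]]|.

(** The automorphism factors turn the two isomorphism conditions into numbers of isomorphisms. *)
Lemma subcount_isos G : (subcount G * (aut2 A * aut2 B))%N =
  (\sum_(E : {set gH G} | edgeset E) #|isos (subg E) A| * #|isos (contr E) B|)%N.
Proof.
rewrite /subcount -sum1_card big_distrl /= big_mkcond [RHS]big_mkcond /=.
apply: eq_bigr => E _; rewrite inE !card_isos; case: ifP => [/and3P[-> -> ->]|].
  by rewrite !mul1n.
case: (edgeset E) => //=.
by case: (iso2b (subg E) A); case: (iso2b (contr E) B); rewrite ?mul0n ?muln0.
Qed.

(** Double count of quadruples [(d, E, p, r)]: a labelling [p] of [A] and an isomorphism [r] of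
    cores determine the pair [(d, E)]. *)
Lemma sum_subcount a b c : #|gV A| = a -> #|gH A| = b -> #|gS A| = c ->
  (\sum_(d : Raw a b c | valid2 (ograph d)) subcount (ograph d) * (aut2 A * aut2 B))%N
  = (fact3 a b c * #|isos (core (rsd A)) (core B)|)%N.
Proof.
move=> Aa Ab Ac; pose I0 := isos (core (rsd A)) (core B).
pose Q (d : Raw a b c) (E : {set 'I_b})
    (y : lab a b c A * tri (core (rsd A)) (core B)) :=
  [&& y.1 \in isos (@subg (ograph d) E) A, y.2 \in I0 &
      @compat (ograph d) A B y.1 y.2].
transitivity (\sum_(d : Raw a b c | valid2 (ograph d))
    \sum_(E : {set 'I_b} | @edgeset (ograph d) E) \sum_(y | Q d E y) 1)%N.
  apply: eq_bigr => d vd; rewrite subcount_isos; apply: eq_bigr => E EE.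
  transitivity (\sum_(p : lab a b c A | p \in isos (@subg (ograph d) E) A)
     \sum_(r | (r \in I0) && @compat (ograph d) A B p r) 1)%N.
    rewrite -sum1_card big_distrl /=.
    apply: eq_bigr => p pi; rewrite mul1n (card_isos_contr B vd vA EE pi).
    by rewrite -sum1_card; apply: eq_bigl => r; rewrite in_set.
  by rewrite pair_big_dep.
rewrite pair_big_dep /=.
rewrite (exchange_big_dep (mem (setX (bijs a b c A) I0))) /=; last first.
  move=> x [p r] _ /and3P[/= pi ri _]; rewrite inE /= ri andbT.
  by move: pi; rewrite !inE => /and5P[-> -> -> _ _].
rewrite -(@card_bijs a b c A) // -cardsX -sum1_card; apply: eq_bigr => -[p r].
rewrite inE => /andP[/= pb ri].
have [d0 [E0 uniq]] := insertion_unique vA vB ri pb.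
rewrite (big_pred1 (d0, E0)) // => -[d E]; rewrite /Q /= ri /= -andbA uniq.
by rewrite xpair_eqE.
Qed.

Local Notation a := #|gV A|.
Local Notation b := #|gH A|.
Local Notation c := #|gS A|.

Lemma DeltaX5E : DeltaX5 A B =
  ((#|isos (core (rsd A)) (core B)|)%:R / ((aut2 A)%:R * (aut2 B)%:R))%R.
Proof.
have aut0 G : ((aut2 G)%:R : rat) != 0%R by rewrite pnatr_eq0 -lt0n aut2_gt0.
have f0 := fact3_neq0 a b c.
(* The automorphism denominator of [Xser] and the class size in [classsum] multiply to the number of
   labellings. *)
transitivity (\sum_(d : Raw a b c | valid2 (ograph d))
    (subcount (ograph d))%:R / (fact3 a b c)%:R : rat)%R.
  apply: eq_bigr => d vd; rewrite /Xser vd -(card_class d) natrM invfM.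
  by rewrite mul1r -/(subcount _) [LHS]mulrC mulrA [LHS]mulrC.
rewrite -mulr_suml; apply/eqP; rewrite eqr_div ?mulf_neq0 ?aut0 //.
rewrite -natr_sum -!natrM eqr_nat big_distrl /= (@sum_subcount a b c) //.
by rewrite mulnC.
Qed.

End LeftSide.

(** * The coefficients of the product over the vertices *)

Section Decomposition.
Variables (A G : graph2).
Hypotheses (vA : valid2 A) (vG : valid2 G).

Section Family.
Variable F : gV G -> graph2.

(** Both [p] and [r] colour the vertices of [A] by the vertices of [G], through summands and through
    components respectively; here the two colourings agree. *)
Definition matched (p : tri (dunion F) A) (r : tri (core (rsd A)) (core G)) :=
  [forall v, forall x : gV (F v),
     tV r (cls (all_edges A) (tV p (existT _ v x))) == v].

Lemma summand_emb p v : p \in isos (dunion F) A -> emb (comp3 p (inj_tri F v)).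
Proof. by move=> /isosP[ep _]; apply: emb_comp => //; apply: inj_emb. Qed.

(** For fixed [p], the residues of the summands cover the core of the residue of [A], the stars of
    [G] cover its core, and a matched [r] is an isomorphism over these covers. *)
Lemma card_matched_rsd p : p \in isos (dunion F) A ->
  #|[set r in isos (core (rsd A)) (core G) | matched p r]|
  = (\prod_v #|isos (core (rsd (F v))) (star (vgraph v))|)%N.
Proof.
move=> pi; pose e v := comp3 p (inj_tri F v).
have ee v : emb (e v) by apply: summand_emb.
have [de ce] : covers e by apply: (cover_comp pi); apply: inj_cover.
have vF v : valid2 (F v) by apply: emb_valid (ee v) vA.
have [f ef fV] : exists2 f : forall v, tri (core (rsd (F v))) (core (rsd A)),
    forall v, emb (f v) & forall v x, tV (f v) (cls _ x) = cls _ (tV (e v) x).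
  apply: (@fin_all_exists2 _ (fun v => tri (core (rsd (F v))) (core (rsd A)))
     (fun v g => emb g) (fun v g => forall x, tV g (cls _ x) = cls _ (tV (e v) x))).
  by move=> v; apply: rsd_emb.
have cf : covers f.
  split=> [i j C D|C].
    have [x ->] := clsP C; have [y ->] := clsP D; rewrite !fV => /cls_eq.
    have iY : involutive (iotaE (all_edges A)).
      by move=> h; rewrite !iotaE_all; case/validP: vA.
    move=> /(emb_connect_image (emb_all (vF i) vA (ee i)) iY)[z zE _].
    exact: de (esym zE).
  have [y ->] := clsP C; have [v [x ->]] := ce y.
  by exists v, (cls _ x); rewrite fV.
have es v : emb (star_tri (X := G) v).
  by apply: star_emb; case/validP: vG.
have cs : covers (fun v => star_tri (X := G) v).
  split=> [v w x y|v]; first by rewrite !mkV.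
  by exists v, tt; rewrite mkV.
rewrite -(card_isos_over ef cf es cs); apply: eq_card => r.
rewrite !in_set; congr andb; apply: eq_forallb => v.
apply/forallP/forallP => H.
  move=> C; have [x ->] := clsP C; apply/existsP; exists tt.
  by have /eqP := H x; rewrite fV !mkV => ->.
move=> x; have /existsP[y /eqP] := H (cls _ x).
by rewrite fV !mkV => ->.
Qed.

Lemma color_iota (r : tri (core (rsd A)) (core G)) h :
  tV r (cls (all_edges A) (gnu A (giota A h))) = tV r (cls (all_edges A) (gnu A h)).
Proof.
congr (tV r _); apply/cls_eq/connect1/orP; right.
by apply/existsP; exists h; rewrite iotaE_all !eqxx.
Qed.

(** For fixed [r], the summands cover the disjoint union, the colour classes of [r] cover [A], and a
    matched [p] is an isomorphism over these covers. *)
Lemma card_matched_summands r :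
  #|[set p in isos (dunion F) A | matched p r]|
  = (\prod_v #|isos (F v) (restr (fun x => tV r (cls (all_edges A) x)) v)|)%N.
Proof.
rewrite -(card_isos_over (inj_emb F) (inj_cover F)
  (restr_emb vA (color_iota r)) (restr_cover _)).
apply: eq_card => p; rewrite !in_set; congr andb; apply: eq_forallb => v.
apply: eq_forallb => x; apply/idP/existsP => [H|[y /eqP]]; last first.
  by rewrite !mkV => ->; rewrite (valP y).
exists (exist (fun x => tV r (cls (all_edges A) x) == v) _ H).
by rewrite !mkV.
Qed.

Lemma sum_matched :
  (\sum_(p in isos (dunion F) A) #|[set r in isos (core (rsd A)) (core G) | matched p r]|
   = \sum_(r in isos (core (rsd A)) (core G)) #|[set p in isos (dunion F) A | matched p r]|)%N.
Proof.
transitivity (\sum_(p in isos (dunion F) A)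
  \sum_(r in isos (core (rsd A)) (core G) | matched p r) 1)%N.
  by apply: eq_bigr => p _; rewrite -sum1_card; apply: eq_bigl => r; rewrite in_set.
rewrite (exchange_big_dep (mem (isos (core (rsd A)) (core G)))) /=; last first.
  by move=> p r _ /andP[].
apply: eq_bigr => r ri; rewrite -sum1_card; apply: eq_bigl => p.
by rewrite in_set ri.
Qed.

End Family.

Local Notation a := #|gV A|.
Local Notation b := #|gH A|.
Local Notation c := #|gS A|.

Local Open Scope ring_scope.

(** At each [v], class size times automorphisms gives [boxfact], and [aut1] times the indicator in
    [Xgam] counts isomorphisms from the residue to the star; validity of the summands comes from
    [p]. *)
Lemma prodcoef_term (t : {ffun gV G -> Box a b c}) p :
  p \in isos (dunion (fun v => oG (t v))) A ->
  \prod_(v : gV G)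
     ((clsz (t v))%:R^-1 * (aut1 (vgraph v))%:R * Xgam (vgraph v) (oG (t v)))
  = (\prod_v (boxfact (t v))%:R^-1) *
    (#|[set r in isos (core (rsd A)) (core G) | matched p r]|)%:R.
Proof.
move=> pi; rewrite (card_matched_rsd pi) natr_prod -big_split /=.
apply: eq_bigr => v _; rewrite card_isos_rsd_star /Xgam.
have -> : valid2 (oG (t v)).
  exact: emb_valid (@summand_emb (fun v => oG (t v)) p v pi) vA.
rewrite -clsz_aut !natrM invfM /= -!mulrA; congr (_ * _).
by rewrite mulrA mulrC [(aut1 _)%:R * _]mulrC.
Qed.

Lemma prodcoefE : prodcoef G A =
  (#|isos (core (rsd A)) (core G)|)%:R / (aut2 A)%:R.
Proof.
have aut0 : ((aut2 A)%:R : rat) != 0 by rewrite pnatr_eq0 -lt0n aut2_gt0.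
(* The factor [aut2 A] turns the indicator that the disjoint union is isomorphic to [A] into a sum
   over isomorphisms [p]. *)
apply: (mulIf aut0); rewrite divfK // /prodcoef big_distrl /=.
transitivity (\sum_(t : {ffun gV G -> Box a b c})
   \sum_(r in isos (core (rsd A)) (core G))
   \prod_v ((boxfact (t v))%:R^-1 *
     (#|isos (oG (t v)) (restr (fun x => tV r (cls (all_edges A) x)) v)|)%:R : rat)).
  apply: eq_bigr => t _; pose D := dunion (fun v => oG (t v)).
  rewrite mulrAC -natrM -card_isos -sum1_card natr_sum big_distrl /=.
  rewrite (eq_bigr _ (fun p pi => etrans (mul1r _) (prodcoef_term pi))).
  rewrite -mulr_sumr -natr_sum [X in X%:R](sum_matched (fun v => oG (t v))).
  rewrite natr_sum mulr_sumr.
  apply: eq_bigr => r _; rewrite card_matched_summands natr_prod.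
  by rewrite -big_split.
rewrite exchange_big -[X in _ = X%:R]sum1_card natr_sum; apply: eq_bigr => r _.
(* For fixed [r] the sum over families is a product over [v] of sums over single boxes, each equal
   to 1, so every [r] contributes 1. *)
rewrite -(bigA_distr_bigA (fun v (x : Box a b c) => (boxfact x)%:R^-1 *
  (#|isos (oG x) (restr (fun x => tV r (cls (all_edges A) x)) v)|)%:R)).
apply: big1 => v _; have [ka kb kc] := emb_card
  (@restr_emb _ _ (fun x => tV r (cls (all_edges A) x)) vA (color_iota r) v).
exact: sum_box_weighted.
Qed.

End Decomposition.

Lemma RHS5E (A B : graph2) : valid2 A -> valid2 B -> RHS5 A B =
  ((#|isos (core (rsd A)) (core B)|)%:R / ((aut2 A)%:R * (aut2 B)%:R))%R.
Proof.
move=> vA vB; set N := #|isos _ _|.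
pose K := fact3 #|gV B| #|gH B| #|gS B|.
have K0 : (K%:R != 0 :> rat)%R by apply: fact3_neq0.
have aut0 G : ((aut2 G)%:R : rat)%R != 0%R by rewrite pnatr_eq0 -lt0n aut2_gt0.
transitivity (\sum_(d : Raw #|gV B| #|gH B| #|gS B|)
   N%:R / (aut2 A)%:R / K%:R / (aut2 B)%:R * (#|isos (ograph d) B|)%:R : rat)%R.
  (* The sum extends to all [d], since an invalid 2-graph is isomorphic to no valid [B]. *)
  rewrite /RHS5 /classsum big_mkcond; apply: eq_bigr => d _.
  rewrite card_isos iso2bE; case: (set_0Vmem (isos (ograph d) B)) => [->|[p pi]].
    by rewrite cards0 /= !mul0r !mulr0 mul0r; case: ifP.
  have [ep sp] := (isosP _).1 pi; have vd := emb_valid ep vB.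
  rewrite vd (prodcoefE vA vd).
  have -> : #|isos (core (rsd A)) (core (ograph d))| = N.
    apply: (@card_isos_r _ _ _ (p : tri (core (ograph d)) (core B))).
    by apply/isosP; split=> //; apply: emb_core.
  have -> : (0 < #|isos (ograph d) B|)%N by rewrite card_gt0; apply/set0Pn; exists p.
  rewrite mul1n mul1r /K -(card_class d) natrM invfM.
  by rewrite mulfVK // -!mulrA; congr (_ * (_ * _))%R; rewrite mulrC.
rewrite -big_distrr /= -natr_sum sum_isos_labels card_bijs // -/K invfM.
by rewrite mulrAC divfK // mulrA.
Qed.

Theorem mainTheorem5 :
  forall A B : graph2, valid2 A -> valid2 B -> DeltaX5 A B = RHS5 A B.
Proof. by move=> A B vA vB; rewrite DeltaX5E // RHS5E. Qed.
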